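(* Let $\Gamma$ be a non-empty finite connected graph, $\mathcal{L}(\Gamma)$ a labeled graph over $\Gamma$, $G$ the GBS-group defined by $\mathcal{L}(\Gamma)$, and $\Delta\colon G\to\mathbb{Q}^*$ its modular homomorphism. Let $G$ be not solvable, $\mathcal{L}(\Gamma)$ be reduced, and $\rho$ be a non-empty set of primes. The following statements are equivalent. 1. $G$ is residually a finite $\rho$-group. 2. $G$ is residually a finite solvable $\rho$-group. 3. $G$ is residually a periodic $\rho$-group of finite exponent. 4. $G$ is residually a periodic solvable $\rho$-group of finite exponent. 5. $\operatorname{Im}\Delta\subseteq\{1,-1\}$, all the labels of $\mathcal{L}(\Gamma)$ are $\rho$-numbers, and if $-1\in\operatorname{Im}\Delta$, then $2\in\rho$.
   Context: For a class $\mathcal{C}$ of groups, a group $G$ is residually a $\mathcal{C}$-group if for every non-unit $g\in G$ there is a homomorphism $\sigma$ of $G$ onto a group of $\mathcal{C}$ with $g\sigma\neq 1$. For a set $\rho$ of primes, a $\rho$-number is an integer all of whose prime divisors belong to $\rho$, and a $\rho$-group is a periodic group in which the orders of all elements are $\rho$-numbers. $\mathrm{BS}(m,n)=\langle a,b;\ a^{-1}b^ma=b^n\rangle$ for non-zero integers $m,n$. Labeled graphs and GBS-groups. $\Gamma=(V,E)$ is a non-empty finite connected undirected graph (loops and multiple edges allowed). The ends of an edge $e$ are denoted $e(1),e(-1)$ (in a fixed order; they coincide if $e$ is a loop). A labeled graph $\mathcal{L}(\Gamma)$ is obtained by assigning to each $e\in E$ non-zero integers $\lambda(+e)$ (at $e(1)$)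 and $\lambda(-e)$ (at $e(-1)$), called labels; we write $\lambda(\varepsilon e)$, $\varepsilon=\pm1$. Fix a maximal subtree $T$ of $\Gamma$ with edge set $E_T$. The GBS-group defined by $\mathcal{L}(\Gamma)$ (the fundamental group of the corresponding graph of infinite cyclic groups) is the group $G=\pi_1(\mathcal{L}(\Gamma))$ with generators $g_v$ ($v\in V$), $t_e$ ($e\in E\setminus E_T$) and defining relations $g_{e(1)}^{\lambda(+e)}=g_{e(-1)}^{\lambda(-e)}$ ($e\in E_T$), $t_e^{-1}g_{e(1)}^{\lambda(+e)}t_e=g_{e(-1)}^{\lambda(-e)}$ ($e\in E\setminus E_T$); up to isomorphism it does not depend on $T$. The vertex groups are the subgroups $G_v=\langle g_v\rangle$, which are infinite cyclic. $\mathcal{L}(\Gamma)$ is reduced if for all $e\in E$, $\varepsilon=\pm1$, $|\lambda(\varepsilon e)|=1$ implies that $e$ is a loop. $G$ is elementary if it is isomorphic to $\mathbb{Z}$, $\mathrm{BS}(1,1)$ or $\mathrm{BS}(1,-1)$ (elementary groups are solvable). An element of $G$ is elliptic if it is conjugate to an element of some vertex group. Modular homomorphism. If $G$ is not elementary, $\Delta\colon G\to\mathbb{Q}^*$ is defined as follows: for $g\in G$ take any non-unit elliptic element $a$ and non-zero integers $m,n$ with $g^{-1}a^mg=a^n$ (they exist), and put $\Delta(g)=n/m$; this is a well-defined homomorphism independent of the choices. *)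

(* Defs.v *)
From HB Require Import structures.
From mathcomp Require Import all_boot all_order all_algebra.
From mathcomp Require Import boolp classical_sets cardinality.

Set Implicit Arguments.
Unset Strict Implicit.
Unset Printing Implicit Defensive.

Local Open Scope classical_set_scope.
Local Open Scope group_scope.

Section Groups.
Implicit Types (G H : groupType) (rho : nat_pred).

Definition expgz G (x : G) (k : int) : G :=
  match k with Posz n => x ^+ n | Negz n => x ^- n.+1 end.

Definition subgroup G (A : set G) : Prop :=
  A 1 /\ forall x y, A x -> A y -> A (x * y^-1).

Fixpoint derived_series G (n : nat) {struct n} : set G :=
  if n is m.+1 then
    smallest (@subgroup G)
      [set z | exists x y : G, [/\ derived_series m x, derived_series m y
                                 & z = [~ x, y]]]
  else setT.

Definition solvable_group G : Prop :=
  exists n, @derived_series G n = [set 1].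

Definition has_order G (x : G) (n : nat) : Prop :=
  [/\ (0 < n)%N, x ^+ n = 1
    & forall m : nat, (0 < m)%N -> x ^+ m = 1 -> (n <= m)%N].

Definition periodic_group G : Prop := forall x : G, exists n, has_order x n.

Definition rho_group rho G : Prop :=
  periodic_group G /\
  forall (x : G) (n : nat), has_order x n -> rho.-nat n.

Definition finite_group G : Prop := finite_set [set: G].

Definition finite_exponent G : Prop :=
  exists2 n : nat, (0 < n)%N & forall x : G, x ^+ n = 1.

Definition residually (C : groupType -> Prop) G : Prop :=
  forall g : G, g <> 1 ->
    exists (H : groupType) (sigma : {multiplicative G -> H}),
      [/\ C H, (forall h : H, exists x : G, sigma x = h) & sigma g <> 1].

End Groups.

Section Presentation.
Variable X : choiceType.

(* The letter (x, true) stands for x and (x, false) for its formal inverse. *)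
Definition word : Type := seq (X * bool).
HB.instance Definition _ := Choice.on word.

Definition inv_word (w : word) : word := rev [seq (l.1, ~~ l.2) | l <- w].

Definition pow_word (x : X) (k : int) : word :=
  nseq `|k|%N (x, (0 <= k)%R).

Variable R : word -> word -> Prop.

Inductive pres_eq : word -> word -> Prop :=
  | pres_refl u : pres_eq u u
  | pres_sym u v : pres_eq u v -> pres_eq v u
  | pres_trans u v w : pres_eq u v -> pres_eq v w -> pres_eq u w
  | pres_cat u u' v v' :
      pres_eq u u' -> pres_eq v v' -> pres_eq (u ++ v) (u' ++ v')
  | pres_cancel x b : pres_eq [:: (x, b); (x, ~~ b)] [::]
  | pres_rel u v : R u v -> pres_eq u v.

Definition pres_eqb (u v : word) : bool := `[< pres_eq u v >].

Lemma pres_eqb_refl : reflexive pres_eqb.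
Proof. by move=> u; apply/asboolP; exact: pres_refl. Qed.

Lemma pres_eqb_sym : symmetric pres_eqb.
Proof. by move=> u v; apply/asboolP/asboolP; exact: pres_sym. Qed.

Lemma pres_eqb_trans : transitive pres_eqb.
Proof.
move=> v u w /asboolP uv /asboolP vw; apply/asboolP; exact: pres_trans uv vw.
Qed.

Canonical pres_equiv := EquivRel pres_eqb pres_eqb_refl pres_eqb_sym pres_eqb_trans.

(* The group < X ; u = v for all u, v such that R u v >. *)
Definition presented : Type := {eq_quot pres_equiv}%qT.
HB.instance Definition _ := Choice.on presented.
HB.instance Definition _ := EqQuotient.on presented.

Definition class_of (w : word) : presented := (\pi_presented w)%qT.

Lemma class_ofP u v : class_of u = class_of v <-> pres_eq u v.
Proof.
split; first by move/eqquotP/asboolP.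
by move=> uv; apply/eqquotP/asboolP.
Qed.

Lemma pres_reprP (w : word) : pres_eq (repr (class_of w)) w.
Proof. by apply/class_ofP; rewrite /class_of reprK. Qed.

Definition pres_mul (a b : presented) : presented := class_of (repr a ++ repr b).
Definition pres_one : presented := class_of [::].
Definition pres_inv (a : presented) : presented := class_of (inv_word (repr a)).

Lemma class_repr (a : presented) : class_of (repr a) = a.
Proof. exact: reprK. Qed.

Lemma pres_mulE u v : pres_mul (class_of u) (class_of v) = class_of (u ++ v).
Proof. by apply/class_ofP; apply: pres_cat; exact: pres_reprP. Qed.

Lemma pres_mulA : associative pres_mul.
Proof.
move=> a b c; rewrite -(class_repr a) -(class_repr b) -(class_repr c).
by rewrite !pres_mulE catA.
Qed.

Lemma pres_mul1 : left_id pres_one pres_mul.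
Proof. by move=> a; rewrite -(class_repr a) pres_mulE. Qed.

Lemma pres_mulr1 : right_id pres_one pres_mul.
Proof. by move=> a; rewrite -(class_repr a) pres_mulE cats0. Qed.

Lemma pres_word_cancel (w : word) : pres_eq (w ++ inv_word w) [::].
Proof.
elim/last_ind: w => [|w [x b] IHw]; first exact: pres_refl.
rewrite /inv_word map_rcons rev_rcons cat_rcons.
apply: pres_trans IHw.
rewrite -[_ :: _ :: _]/([:: (x, b); (x, ~~ b)] ++ inv_word w).
apply: pres_cat; first exact: pres_refl.
rewrite -[X in pres_eq _ X]cat0s.
by apply: pres_cat; [exact: pres_cancel | exact: pres_refl].
Qed.

Lemma inv_wordK : involutive inv_word.
Proof.
move=> w; rewrite /inv_word map_rev revK -map_comp -[RHS]map_id.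
by apply: eq_map => -[x b] /=; rewrite negbK.
Qed.

Lemma pres_mulV : right_inverse pres_one pres_inv pres_mul.
Proof.
move=> a; rewrite /pres_inv -{1}(class_repr a) pres_mulE.
by apply/class_ofP; exact: pres_word_cancel.
Qed.

Lemma pres_Vmul : left_inverse pres_one pres_inv pres_mul.
Proof.
move=> a; rewrite /pres_inv -{2}(class_repr a) pres_mulE.
apply/class_ofP; rewrite -{2}[repr a]inv_wordK.
exact: pres_word_cancel.
Qed.

HB.instance Definition _ :=
  isGroup.Build presented pres_mulA pres_mul1 pres_mulr1 pres_Vmul pres_mulV.

End Presentation.

(* edge_end e true and edge_end e false are the ends e(1) and e(-1). *)
Record graph := Graph {
  vertex : finType;
  edge : finType;
  edge_end : edge -> bool -> vertex
}.

Section Graphs.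
Variable Gamma : graph.
Notation V := (vertex Gamma).
Notation E := (edge Gamma).
Implicit Types (W : {set V}) (F : {set E}).

Definition is_loop (e : E) : Prop := edge_end e true = edge_end e false.

Definition adjacent F : rel V := fun u v =>
  [exists e in F, [exists b, (edge_end e b == u) && (edge_end e (~~ b) == v)]].

(* (e, b) is the edge e traversed from edge_end e b to edge_end e (~~ b). *)
Definition source (x : E * bool) : V := edge_end x.1 x.2.
Definition target (x : E * bool) : V := edge_end x.1 (~~ x.2).

(* A closed walk repeating neither an edge nor a vertex; loops and pairs of
   parallel edges give circuits of length 1 and 2. *)
Definition is_circuit (s : seq (E * bool)) : Prop :=
  [/\ s <> [::], cycle (fun x y => target x == source y) s,
      uniq [seq x.1 | x <- s] & uniq [seq source x | x <- s]].

Definition is_subgraph W F : Prop :=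
  forall e b, e \in F -> edge_end e b \in W.

Definition is_connected W F : Prop :=
  {in W &, forall u v, connect (adjacent F) u v}.

Definition is_acyclic F : Prop :=
  forall s, is_circuit s -> ~ {in s, forall x, x.1 \in F}.

Definition is_subtree W F : Prop :=
  [/\ is_subgraph W F, W != finset.set0, is_connected W F & is_acyclic F].

Definition maximal_subtree W F : Prop :=
  is_subtree W F /\
  forall W' F', is_subtree W' F' -> W \subset W' -> F \subset F' ->
    W' = W /\ F' = F.

Definition connected_graph : Prop := is_connected finset.setT finset.setT.

End Graphs.

(* lam e true and lam e false are the labels of e at e(1) and at e(-1). *)
Definition labeling (Gamma : graph) : Type := edge Gamma -> bool -> int.

Definition reduced_labeling (Gamma : graph) (lam : labeling Gamma) : Prop :=
  forall e b, `|lam e b|%N = 1%N -> is_loop e.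

Section GBS.
Variables (Gamma : graph) (lam : labeling Gamma).
Variable ET : {set edge Gamma}.

Definition gbs_gen : choiceType :=
  (vertex Gamma + {e : edge Gamma | e \notin ET})%type.

Definition gbs_side (e : edge Gamma) (b : bool) : word gbs_gen :=
  pow_word (inl (edge_end e b) : gbs_gen) (lam e b).

Definition gbs_stable (e : {e : edge Gamma | e \notin ET}) : word gbs_gen :=
  [:: (inr e : gbs_gen, true)].

Inductive gbs_rel : word gbs_gen -> word gbs_gen -> Prop :=
  | gbs_rel_tree (e : edge Gamma) :
      e \in ET -> gbs_rel (gbs_side e true) (gbs_side e false)
  | gbs_rel_stable (e : {e : edge Gamma | e \notin ET}) :
      gbs_rel
        (inv_word (gbs_stable e) ++ gbs_side (val e) true ++ gbs_stable e)
        (gbs_side (val e) false).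

Definition gbs_group : groupType := presented gbs_rel.

Definition gbs_vertex (v : vertex Gamma) : gbs_group :=
  class_of gbs_rel [:: (inl v : gbs_gen, true)].

Definition elliptic (a : gbs_group) : Prop :=
  exists v (k : int) x, a = expgz (gbs_vertex v) k ^ x.

Definition modular_value (g : gbs_group) (q : rat) : Prop :=
  exists a (m n : int),
    [/\ elliptic a, a <> 1, m <> 0%R, n <> 0%R
      & expgz a m ^ g = expgz a n /\ q = (n%:~R / m%:~R)%R].

(* The default value 1 is irrelevant: when the group is not elementary, every g has
   exactly one modular value. *)
Definition Delta (g : gbs_group) : rat := xget 1%R (modular_value g).

End GBS.

Arguments Delta {Gamma} lam ET g.

(* Main.v *)
(* Sending g_v to a translation by an integer c_v, compatibly with the tree, and t_e to the
   dilation making the relations hold represents G by affine bijections of the rationals;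
   it is injective on the vertex groups and its linear part is the inverse of Delta.

   Britton's lemma, and the residual finiteness, come from one construction. Let theta
   be a morphism from G to a group Q that keeps reduced paths reduced. Let Q act by
   shifts on functions on {0, ..., L} x Q with values in F_p, and attach to each edge
   two transvections raising the layer by one on a coset of the image of the edge
   group: they commute with this image, so G acts, and the cosets can be chosen along a
   given reduced path so that its value moves a function of layer 0 up to layer L. For
   Q the affine group this shows that the values of reduced closed paths are
   nontrivial. If Delta takes its values in {1, -1} and the labels are rho-numbers, then
   Q can be a finite group of maps x |-> +-x + t of Z/N; the group acting is then an
   extension of Q by a p-group, hence a finite solvable rho-group.

   Conversely, let G be residually a periodic rho-group. If b^m and b^n are conjugate by
   g with m, n coprime, then in periodic quotients the order of b is coprime to m and n,
   so all conjugates of b by powers of g commute with whatever has a power equal to b. If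
   Delta(g) is not 1 or -1, this gives elliptic elements outside a given vertex group that
   commute with any prescribed finite set of elliptic elements; Britton's lemma then
   leaves a single loop with a label 1 or -1, and G is solvable. If a prime q outside rho
   divides a label k at v, then g_v^(k/q) is a power of g_v^k in all the quotients, which
   gives a commutation relation contradicting Britton's lemma. If Delta(g) = -1, then g
   inverts an element of infinite order, which dies in periodic quotients without
   2-torsion. *)

Require Import Defs.
From HB Require Import structures.
From mathcomp Require Import all_boot all_order all_algebra.
From mathcomp Require Import boolp classical_sets cardinality.
From mathcomp Require Import zify ring lra.

Set Implicit Arguments.
Unset Strict Implicit.
Unset Printing Implicit Defensive.

Import Order.TTheory GRing.Theory Num.Theory.
Local Open Scope group_scope.

(** * Integer powers in groups and under morphisms *)

Section IntPowers.
Implicit Types G H : groupType.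

Lemma expgz_nat G (x : G) (n : nat) : expgz x n = x ^+ n.
Proof. by []. Qed.

Lemma expgz_addS G (x : G) (k : int) : expgz x (k + 1)%R = expgz x k * x.
Proof.
case: k => [n|n]; first by rewrite -PoszD addn1 /= expgSr.
case: n => [|n]; first by rewrite /= expg1 mulVg.
have -> : (Negz n.+1 + 1 = Negz n)%R by rewrite !NegzE; lia.
by rewrite /= [x ^+ n.+2]expgS invgM mulgVK.
Qed.

Lemma expgz_subS G (x : G) (k : int) : expgz x (k - 1)%R = expgz x k * x^-1.
Proof. by rewrite -{2}[k](subrK 1%R) expgz_addS mulgK. Qed.

Lemma expgzD G (x : G) (k l : int) : expgz x (k + l)%R = expgz x k * expgz x l.
Proof.
elim: l => [|l IHl|l IHl]; first by rewrite addr0 mulg1.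
  by rewrite -addn1 PoszD addrA !expgz_addS IHl mulgA.
by rewrite -addn1 PoszD opprD addrA !expgz_subS IHl mulgA.
Qed.

Lemma expgzN G (x : G) (k : int) : expgz x (- k)%R = (expgz x k)^-1.
Proof.
apply/(mulIg (expgz x k)); rewrite mulVg -expgzD addNr //.
Qed.

Lemma expgzM G (x : G) (k l : int) : expgz x (k * l)%R = expgz (expgz x k) l.
Proof.
elim: l => [|l IHl|l IHl]; first by rewrite mulr0.
  by rewrite -addn1 PoszD expgz_addS -IHl -expgzD mulrDr mulr1.
rewrite -addn1 PoszD opprD expgz_subS -IHl -expgzN -expgzD.
by rewrite mulrDr mulrN1.
Qed.

Lemma expgz_conj G (x y : G) (k : int) : expgz (x ^ y) k = expgz x k ^ y.
Proof.
by case: k => n /=; rewrite ?conjVg conjXg.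
Qed.

Lemma mult1 G H (f : {multiplicative G -> H}) : f 1 = 1.
Proof. by apply/(mulgI (f 1)); rewrite -gmulfM !mulg1. Qed.

Lemma multV G H (f : {multiplicative G -> H}) x : f x^-1 = (f x)^-1.
Proof. by apply/(mulgI (f x)); rewrite -gmulfM !mulgV mult1. Qed.

Lemma multX G H (f : {multiplicative G -> H}) x n : f (x ^+ n) = f x ^+ n.
Proof. by elim: n => [|n IHn]; rewrite ?mult1 // !expgS gmulfM IHn. Qed.

Lemma multJ G H (f : {multiplicative G -> H}) x y : f (x ^ y) = f x ^ f y.
Proof. by rewrite !gmulfM multV. Qed.

Lemma mult_expgz G H (f : {multiplicative G -> H}) x k :
  f (expgz x k) = expgz (f x) k.
Proof. by case: k => n; rewrite /= ?multV multX. Qed.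

Lemma expgz1 G (k : int) : expgz (1 : G) k = 1.
Proof. by case: k => n; rewrite /= expg1n ?invg1. Qed.

Lemma commute_expgz G (x y : G) (k : int) : commute x y -> commute x (expgz y k).
Proof. by case: k => n xy; [exact: commuteX|apply/commuteV/commuteX]. Qed.

Lemma commute_expgz2 G (x : G) (k l : int) : commute (expgz x k) (expgz x l).
Proof. by rewrite /commute -!expgzD addrC. Qed.

Lemma commute_conj G (x y z : G) : commute x y -> commute (x ^ z) (y ^ z).
Proof. by rewrite /commute -!conjMg => ->. Qed.

End IntPowers.

(** * Groups of bijections and morphisms out of presented groups *)

(** The inverse is part of the data, so that inversion in the group merely exchanges fields;
    [bijectionP] shows that the underlying map still determines the element. *)
Record bijection (T : Type) := Bijection {
  bij_fun :> T -> T;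
  bij_inv : T -> T;
  bij_funK : cancel bij_fun bij_inv;
  bij_invK : cancel bij_inv bij_fun }.

Section Bijections.
Variable T : Type.

Lemma bijectionP (f g : bijection T) : bij_fun f =1 bij_fun g -> f = g.
Proof.
case: f g => [f f' fK f'K] [g g' gK g'K] /= /funext fg; subst g.
have fg' : f' = g' by apply/funext => x; rewrite -{1}[x]g'K fK.
by subst g'; congr Bijection; exact: Prop_irrelevance.
Qed.

HB.instance Definition _ := gen_eqMixin (bijection T).
HB.instance Definition _ := gen_choiceMixin (bijection T).

Definition bij_mul (f g : bijection T) : bijection T :=
  Bijection (can_comp (bij_funK f) (bij_funK g))
            (can_comp (bij_invK g) (bij_invK f)).
Definition bij_one : bijection T :=
  @Bijection T id id (fun=> erefl) (fun=> erefl).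
Definition bij_opp (f : bijection T) : bijection T :=
  Bijection (bij_invK f) (bij_funK f).

Lemma bij_mulA : associative bij_mul.
Proof. by move=> f g h; exact: bijectionP. Qed.
Lemma bij_mul1 : left_id bij_one bij_mul.
Proof. by move=> f; exact: bijectionP. Qed.
Lemma bij_mulr1 : right_id bij_one bij_mul.
Proof. by move=> f; exact: bijectionP. Qed.
Lemma bij_mulV : left_inverse bij_one bij_opp bij_mul.
Proof. by move=> f; apply: bijectionP => x; exact: bij_funK. Qed.
Lemma bij_mulrV : right_inverse bij_one bij_opp bij_mul.
Proof. by move=> f; apply: bijectionP => x; exact: bij_invK. Qed.

HB.instance Definition _ :=
  isGroup.Build (bijection T) bij_mulA bij_mul1 bij_mulr1 bij_mulV bij_mulrV.

End Bijections.

Section PresentedMorphisms.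
Variables (X : choiceType) (R : word X -> word X -> Prop).

Lemma class_cat (u v : word X) : class_of R (u ++ v) = class_of R u * class_of R v.
Proof. exact/esym/pres_mulE. Qed.

Lemma class_inv (u : word X) : class_of R (inv_word u) = (class_of R u)^-1.
Proof.
apply/(mulgI (class_of R u)); rewrite mulgV -class_cat.
exact/class_ofP/pres_word_cancel.
Qed.

Definition letter (x : X) : presented R := class_of R [:: (x, true)].

Lemma class_letter (x : X) b :
  class_of R [:: (x, b)] = if b then letter x else (letter x)^-1.
Proof. by case: b; rewrite // -class_inv. Qed.

Lemma class_pow (x : X) (k : int) : class_of R (pow_word x k) = expgz (letter x) k.
Proof.
have aux n b : class_of R (nseq n (x, b)) = class_of R [:: (x, b)] ^+ n.
  elim: n => [|n IHn] //; rewrite expgS -IHn -class_cat //.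
by case: k => n; rewrite /pow_word aux class_letter //= expVgn.
Qed.

Lemma presented_ind (P : presented R -> Prop) :
  P 1 -> (forall x g, P g -> P (letter x * g)) ->
  (forall x g, P g -> P ((letter x)^-1 * g)) -> forall g, P g.
Proof.
move=> P1 PM PV g; rewrite -(class_repr g); elim: (repr g) => [|[x b] w IHw] //.
rewrite -cat1s class_cat class_letter; case: b; [exact: PM|exact: PV].
Qed.

Section Lift.
Variables (K : groupType) (f : X -> K).

Definition word_val (w : word X) : K :=
  foldr (fun l g => (if l.2 then f l.1 else (f l.1)^-1) * g) 1 w.

Lemma word_val_cat u v : word_val (u ++ v) = word_val u * word_val v.
Proof. by elim: u => [|l u IHu] /=; rewrite ?mul1g // IHu mulgA. Qed.

Lemma word_val_inv u : word_val (inv_word u) = (word_val u)^-1.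
Proof.
apply/(mulgI (word_val u)); rewrite mulgV -word_val_cat.
elim: u => [|[x b] u IHu] //=; rewrite /inv_word /= rev_cons -rcons_cat -cats1.
rewrite word_val_cat IHu /= mulg1 mul1g.
by case: b; rewrite /= ?mulgV ?mulVg.
Qed.

Lemma word_val_pow x k : word_val (pow_word x k) = expgz (f x) k.
Proof.
have aux n b : word_val (nseq n (x, b)) = (if b then f x else (f x)^-1) ^+ n.
  by elim: n => [|n IHn] //=; rewrite IHn expgS.
by case: k => n; rewrite /pow_word aux //= expVgn.
Qed.

Hypothesis fR : forall u v, R u v -> word_val u = word_val v.

Lemma word_val_eq u v : pres_eq R u v -> word_val u = word_val v.
Proof.
elim=> [//|u1 v1 _ //|u1 v1 w1 _ -> _ //|u1 u2 v1 v2 _ IH1 _ IH2|x b|u1 v1 /fR //].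
  by rewrite !word_val_cat IH1 IH2.
by case: b; rewrite /= mulg1 ?mulgV ?mulVg.
Qed.

(** The compatibility proof is an argument, so that each [pres_lift fR] carries its own morphism
    structure. *)
Definition pres_lift of (forall u v, R u v -> word_val u = word_val v) :=
  fun g : presented R => word_val (repr g).

Lemma pres_lift_class w : pres_lift fR (class_of R w) = word_val w.
Proof. exact/word_val_eq/pres_reprP. Qed.

Lemma pres_lift_morph : {morph pres_lift fR : g h / g * h}.
Proof.
move=> g h; rewrite -(class_repr g) -(class_repr h) -class_cat !pres_lift_class.
exact: word_val_cat.
Qed.

HB.instance Definition _ := isMultiplicative.Build (presented R) K (pres_lift fR) pres_lift_morph.

Lemma pres_lift_letter x : pres_lift fR (letter x) = f x.
Proof. by rewrite pres_lift_class /= mulg1. Qed.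

End Lift.

End PresentedMorphisms.

(** * Alternating products with letters commuting with subgroups *)

Section AlternatingProducts.
Variables (Q : groupType) (Y : eqType) (C : Y -> set Q).
Hypothesis C1 : forall y, C y 1.
Hypothesis CF : forall y c d, C y c -> C y d -> C y (c * d^-1).

(* The triple (q, y, s) stands for q * B y if s, and for q * (B y)^-1 otherwise, where
   the letter B y is only required to commute with the elements of C y. *)
Definition alternating := seq (Q * Y * bool).

Implicit Type m : alternating.

Fixpoint alt_reduced m : Prop :=
  if m is t :: m' then
    (if m' is t' :: _ then t.1.2 = t'.1.2 -> ~ C t.1.2 t'.1.1 else True)
    /\ alt_reduced m'
  else True.

Definition alt_val (K : groupType) (D : Q -> K) (B : Y -> K) m : K :=
  foldr (fun t g => D t.1.1 * (if t.2 then B t.1.2 else (B t.1.2)^-1) * g) 1 m.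

(* Layer l of the transvections is tied to the letter of m that is followed by l - 1
   other letters: it only acts on the coset of C y reached by the product of the
   elements of Q preceding that letter. Two neighbouring equal letters of a reduced
   product select disjoint cosets, so the nilpotent part of a transvection has square
   zero and the inverse of a letter is again a transvection. *)
Fixpoint alt_sel m (x0 : Q) (l : nat) (y : Y) (x : Q) : bool :=
  if m is t :: m' then
    if l == size m then (y == t.1.2) && `[< C y ((x0 * t.1.1)^-1 * x) >]
    else alt_sel m' (x0 * t.1.1) l y x
  else false.

Lemma alt_sel_gt m x0 l y x : (size m < l)%N -> alt_sel m x0 l y x = false.
Proof.
elim: m x0 => [|t m IHm] x0 //= lt_l; rewrite gtn_eqF // IHm //.
exact: ltn_trans lt_l.
Qed.

Lemma alt_sel0 m x0 y x : alt_sel m x0 0 y x = false.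
Proof. by elim: m x0 => [|t m IHm] x0 //=. Qed.

Lemma alt_selC m x0 l y x c : C y c -> alt_sel m x0 l y (x * c) = alt_sel m x0 l y x.
Proof.
move=> Cc; elim: m x0 => [|t m IHm] x0 //=; case: eqP => // _; congr andb.
apply/asboolP/asboolP; rewrite mulgA => Cx; last first.
  have := CF Cx (CF (C1 y) Cc); by rewrite mul1g invgK.
by rewrite -[_ * x](mulgK c); apply: CF.
Qed.

(** Layers [l.+1] and [l] belong to consecutive letters. If both selected [x] for the same [y], the
    element between these letters would be a quotient of two elements of [C y], against
    reducedness. *)
Lemma alt_sel_next m x0 l y x :
  alt_reduced m -> alt_sel m x0 l.+1 y x -> alt_sel m x0 l y x = false.
Proof.
elim: m x0 => [|t m IHm] x0 //= [tm /IHm {}IHm].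
rewrite eqSS; case: eqP => [->|_ lS]; last first.
  case: eqP => [l_eq|_]; last exact: IHm.
  by move: lS; rewrite l_eq alt_sel_gt.
move=> /andP[/eqP -> /asboolP Cx]; rewrite ltn_eqF //.
case: m tm {IHm} => [|t' m] //= tm; rewrite eqxx.
case: eqP => //= /tm nC; apply/asboolP => Cx'; apply: nC.
suff -> : t'.1.1 = (x0 * t.1.1)^-1 * x * ((x0 * t.1.1 * t'.1.1)^-1 * x)^-1.
  exact: CF.
by rewrite !invgM !invgK !mulgA mulgK mulgVK mulVg mul1g.
Qed.

Section Detection.
Variables (F : fieldType) (L : nat) (m0 : alternating).
Hypothesis m0_reduced : alt_reduced m0.
Hypothesis m0_size : size m0 = L.

Notation T := ('I_L.+1 * Q -> F).
Implicit Type v : T.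

(** At layer 0 the predecessor [i.1.-1] is 0 again, but [alt_sel0] shows that this layer is never
    selected. *)
Definition transvection (a : F) (y : Y) v : T := fun i =>
  (v i + (a * v (inord i.1.-1, i.2)) *+ alt_sel m0 1 i.1 y i.2)%R.

Lemma transvectionK a y : cancel (transvection a y) (transvection (- a) y).
Proof.
move=> v; apply/funext => -[l x]; rewrite /transvection /=.
case El: (alt_sel m0 1 l y x); rewrite ?addr0 //= !mulr1n.
have l_gt0 : (0 < l)%N.
  by case: l El => -[|l] //= lt; rewrite alt_sel0.
have l_pred : (l.-1 < L.+1)%N by case: l {El} l_gt0 => -[|l] //= /ltnW.
rewrite inordK // alt_sel_next ?prednK // mulr0n addr0.
by rewrite mulNr addrK.
Qed.

Lemma transvectionNK a y : cancel (transvection (- a) y) (transvection a y).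
Proof. by have := transvectionK (- a) y; rewrite opprK. Qed.

Variables (K : groupType) (D : {multiplicative Q -> K}) (B : Y -> K).
Variable act : K -> T -> T.
Hypothesis actM : forall f g v, act (f * g) v = act f (act g v).
Hypothesis act1 : forall v, act 1 v = v.
Hypothesis actD : forall q v, act (D q) v = fun i => v (i.1, i.2 * q).
Hypothesis actB : forall y v, act (B y) v = transvection 1 y v.

Lemma actBV y v : act (B y)^-1 v = transvection (-1) y v.
Proof.
rewrite -{2}[v]act1 -(mulgV (B y)) actM actB.
by rewrite transvectionK.
Qed.

Definition base_layer : T := fun i => ((i.1 : nat) == 0)%:R%R.

(* Only one term survives at the highest layer: every letter has to contribute its
   nontrivial part, moving the value up by one layer. *)
Lemma alt_val_act m x0 : (size m <= L)%N ->
    (forall l y x, (l <= size m)%N -> alt_sel m0 1 l y x = alt_sel m x0 l y x) ->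
  (forall (l : 'I_L.+1) x, (size m < l)%N ->
     act (alt_val D B m) base_layer (l, x) = 0%R) /\
  act (alt_val D B m) base_layer (inord (size m), x0) <> 0%R.
Proof.
elim: m x0 => [|t m IHm] x0 /= sz_m sel_m.
  by rewrite act1 /base_layer /= inordK //; split=> [[[|l] ?]|] //=; exact/eqP/oner_neq0.
have [|{}IHm IHm0] := IHm (x0 * t.1.1) (ltnW sz_m).
  by move=> l y x le_l; rewrite sel_m 1?leqW //= ltn_eqF.
set e : F := if t.2 then 1%R else (-1)%R.
have e_neq0 : e <> 0%R.
  by apply/eqP; rewrite /e; case: t.2; rewrite ?oppr_eq0 oner_eq0.
have actE v i :
    act (D t.1.1 * (if t.2 then B t.1.2 else (B t.1.2)^-1) * alt_val D B m) v i
    = transvection e t.1.2 (act (alt_val D B m) v) (i.1, i.2 * t.1.1).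
  by rewrite /e !actM actD; case: t.2; rewrite ?actB ?actBV.
split=> [l x lt_l|]; rewrite actE /transvection /=.
  have l_pred : (l.-1 < L.+1)%N := leq_ltn_trans (leq_pred l) (ltn_ord l).
  rewrite (IHm _ _ (ltnW lt_l)) IHm ?mulr0 ?mul0rn ?addr0 //.
  by rewrite inordK // -ltnS (ltn_predK lt_l).
rewrite inordK //= IHm ?inordK // add0r sel_m // eqxx /= eqxx /= mulVg.
rewrite asboolT ?mulr1n; last exact: C1.
by move/eqP; rewrite mulf_eq0 => /orP[] /eqP.
Qed.

(** [base_layer] ignores the coordinate in [Q], so [D q] fixes it. If the whole product were 1, the
    alternating product would fix it too and leave 0 at the top layer, against [alt_val_act]. *)
Lemma alt_val_neq1 q : m0 <> [::] -> alt_val D B m0 * D q <> 1.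
Proof.
move=> m0_neq0 val1.
have [||_] := @alt_val_act m0 1; rewrite ?m0_size //; apply.
have -> : act (alt_val D B m0) base_layer = base_layer.
  have {1}-> : base_layer = act (D q) base_layer by rewrite actD.
  by rewrite -actM val1 act1.
rewrite /base_layer /= inordK //.
by case: m0 m0_neq0 m0_size => [|t m] //= _ <-.
Qed.

End Detection.

End AlternatingProducts.

(** * Forests and spanning trees *)

Lemma uniq_map_inj (A B : eqType) (f : A -> B) (s : seq A) :
  uniq (map f s) -> {in s &, injective f}.
Proof.
elim: s => [|a s IHs] //= /andP[nfa us] x y; rewrite !inE.
move=> /predU1P[->|sx] /predU1P[->|sy] //; last exact: IHs.
  by move=> fxy; case/negP: nfa; rewrite fxy map_f.
by move=> fxy; case/negP: nfa; rewrite -fxy map_f.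
Qed.

Section Forests.
Variable Gamma : graph.
Notation V := (vertex Gamma).
Notation E := (edge Gamma).
Implicit Types (F : {set E}) (W : {set V}).

Definition consecutive : rel (E * bool) := fun x y => target x == source y.

Lemma adjacent_sym F : symmetric (adjacent F).
Proof.
move=> u v; apply/'exists_andP/'exists_andP => -[e [Fe /existsP[b /andP[u_eq v_eq]]]];
  by exists e; split=> //; apply/existsP; exists (~~ b); rewrite negbK u_eq v_eq.
Qed.

Lemma adjacent_connect_sym F : connect_sym (adjacent F).
Proof. exact/sym_connect_sym/adjacent_sym. Qed.

Lemma edge_connect F e b : e \in F ->
  connect (adjacent F) (edge_end e b) (edge_end e (~~ b)).
Proof.
move=> Fe; apply/connect1/existsP; exists e; rewrite Fe.
by apply/existsP; exists b; rewrite !eqxx.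
Qed.

Lemma path_edges F u p : path (adjacent F) u p ->
  exists s, [/\ {in s, forall x, x.1 \in F}, map (@target Gamma) s = p,
    map (@source Gamma) s = belast u p
    & forall x, target x = u -> path consecutive x s].
Proof.
elim: p u => [|v p IHp] u /=; first by exists [::].
move=> /andP[/existsP[e /andP[Fe /existsP[b /andP[/eqP u_eq /eqP v_eq]]]]].
move=> /IHp[s [Fs tgt src cons_s]]; exists ((e, b) :: s); split.
- by move=> x; rewrite inE => /predU1P[->//|/Fs].
- by rewrite /= tgt /target v_eq.
- by rewrite /= src /source u_eq.
- by move=> x xu /=; rewrite /consecutive xu /source u_eq eqxx cons_s.
Qed.

(** If the first edge were used again, both its ends would be among the later vertices, but its
    source [u] is not. *)
Lemma uniq_edges (s : seq (E * bool)) u p : map (@target Gamma) s = p ->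
  map (@source Gamma) s = belast u p -> uniq (u :: p) -> uniq (map fst s).
Proof.
elim: s u p => [|x s IHs] u [|v p] //= [xv sp] [xu su] /and3P[unp vnp p_uniq].
rewrite (IHs v p) ?andbT //= ?vnp //; apply/mapP => -[y sy xy].
case/negP: unp; rewrite -xu /source xy.
have tgt_y : target y \in v :: p by rewrite inE -sp map_f ?orbT.
have src_y : source y \in v :: p by rewrite mem_belast // -su map_f.
by move: tgt_y src_y; rewrite /target /source; case: y.2; case: x.2.
Qed.

Lemma acyclic_sub F F' : F \subset F' -> is_acyclic F' -> is_acyclic F.
Proof. by move=> /fintype.subsetP FF' acF' s /acF' + Fs; apply=> x /Fs /FF'. Qed.

(** A repetition-free path in [F] between the ends of [e] would close up with [e] to a circuit. *)
Lemma acyclic_bridge F e : e \notin F -> is_acyclic (e |: F) ->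
  ~~ connect (adjacent F) (edge_end e true) (edge_end e false).
Proof.
move=> nFe acF; apply/negP => /connectP[p0 /shortenP[p + p_uniq _] v_eq].
move=> /path_edges[s [Fs tgt src cons_s]].
apply: (acF ((e, false) :: s)); last first.
  by move=> x; rewrite !inE => /predU1P[->|/Fs ->]; rewrite ?eqxx ?orbT.
split=> //=.
- rewrite rcons_path cons_s //= /consecutive /source /= v_eq -tgt.
  by case: (s) => //= x s'; rewrite last_map.
- rewrite (uniq_edges tgt src p_uniq) andbT; apply/mapP => -[x /Fs + /= ex].
  by rewrite -ex (negPf nFe).
- by rewrite src /source /= v_eq -rcons_uniq -lastI.
Qed.

Lemma forest_ind (P : {set E} -> Prop) : P finset.set0 ->
  (forall F e, e \notin F ->
    ~~ connect (adjacent F) (edge_end e true) (edge_end e false) ->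
    P F -> P (e |: F)) ->
  forall F, is_acyclic F -> P F.
Proof.
move=> P0 PU F; elim: {F}#|F| {-2}F (erefl #|F|) => [|n IHn] F.
  by move/eqP; rewrite cards_eq0 => /eqP ->.
move=> cF acF; have /card_gt0P[e Fe] : (0 < #|F|)%N by rewrite cF.
have De := finset.setD1K Fe; have nFe : e \notin F :\ e by rewrite !inE eqxx.
rewrite -De; apply: PU => //.
  by apply: acyclic_bridge => //; rewrite De.
apply: IHn; last by apply: acyclic_sub acF; exact: finset.subsetDl.
by move: cF; rewrite (cardsD1 e) Fe => -[].
Qed.

(** When a bridge is added, the potential is multiplied on the left by a constant on one of the
    components it joins; left factors do not affect the relations along the old edges. *)
Lemma group_potential (K : groupType) (b : E -> K) F : is_acyclic F ->
  exists u : V -> K, forall e, e \in F ->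
    u (edge_end e false) = u (edge_end e true) * b e.
Proof.
move: F; apply: forest_ind; first by exists (fun=> 1) => e; rewrite inE.
move=> F e nFe bridge [u uF].
pose t := u (edge_end e true) * b e * (u (edge_end e false))^-1.
exists (fun w => if connect (adjacent F) (edge_end e false) w then t * u w else u w).
move=> f; rewrite !inE => /predU1P[->|Ff]; last first.
  rewrite (same_connect_r (@adjacent_connect_sym F) (edge_connect false Ff)).
  by rewrite uF //; case: ifP; rewrite ?mulgA.
by rewrite connect0 adjacent_connect_sym (negPf bridge) /t mulgVK.
Qed.

(** When a bridge is added, each side is rescaled by the product of label and potential at the
    opposite end. The abstract [P] serves both for nonzero integers and for rho-numbers. *)
Lemma integer_potential (lam : labeling Gamma) (P : int -> Prop) F :
  P 1%R -> (forall a b, P a -> P b -> P (a * b)%R) -> (forall e b, P (lam e b)) ->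
  is_acyclic F -> exists c : V -> int, (forall v, P (c v)) /\
    forall e, e \in F -> (lam e true * c (edge_end e true)
                          = lam e false * c (edge_end e false))%R.
Proof.
move=> P1 PM Plam; move: F; apply: forest_ind.
  by exists (fun=> 1%R); split=> // e; rewrite inE.
move=> F e nFe bridge [c [Pc cF]].
pose t := (lam e true * c (edge_end e true))%R.
pose s := (lam e false * c (edge_end e false))%R.
exists (fun w => ((if connect (adjacent F) (edge_end e false) w then t else s) * c w)%R).
split=> [v|f]; first by apply: (PM) => //; case: ifP => _; apply: PM.
rewrite !inE => /predU1P[->|Ff].
  by rewrite connect0 adjacent_connect_sym (negPf bridge) /t /s; ring.
rewrite (same_connect_r (@adjacent_connect_sym F) (edge_connect false Ff)).
by rewrite mulrCA cF // mulrCA.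
Qed.

End Forests.

Section SpanningTree.
Variables (Gamma : graph) (VT : {set vertex Gamma}) (ET : {set edge Gamma}).
Hypothesis Gamma_connected : connected_graph Gamma.
Hypothesis T_max : maximal_subtree VT ET.

(** Otherwise connectedness gives an edge [e] from a vertex [u] of the tree to a vertex [w] outside,
    and adding both [e] and [w] yields a larger subtree. *)
Lemma maximal_subtree_spans : VT = finset.setT.
Proof.
case: T_max => -[subT T0 connT acT] maxT; apply/setP => w0; rewrite finset.in_setT.
apply: contrapT => /negP w0T; have /finset.set0Pn[v0 v0T] := T0.
have [u [w [uT wT uw]]] : exists u w, [/\ u \in VT, w \notin VT & adjacent finset.setT u w].
  have /connectP[p] := Gamma_connected (finset.in_setT v0) (finset.in_setT w0).
  elim: p v0 v0T => [|v p IHp] v0 v0T /=; first by move=> _ w0_eq; rewrite w0_eq v0T in w0T.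
  move=> /andP[v0v vp] w0_eq; case: (boolP (v \in VT)) => vT; first exact: (IHp v).
  by exists v0, v.
have /existsP[e /andP[_ /existsP[b /andP[/eqP u_eq /eqP w_eq]]]] := uw.
have [] // := maxT (w |: VT) (e |: ET).
- have endT b' : edge_end e b' \in w |: VT.
    by rewrite !inE -w_eq -u_eq in uT *; case: b b' uT {u_eq w_eq} => -[] /= uT;
      rewrite ?uT ?eqxx ?orbT.
  split.
  + move=> f b'; rewrite !inE => /predU1P[->|/subT fT]; last by rewrite fT orbT.
    by move: (endT b'); rewrite !inE.
  + by apply/finset.set0Pn; exists w; rewrite !inE eqxx.
  + have sub_conn : subrel (connect (adjacent ET)) (connect (adjacent (e |: ET))).
      apply: connect_sub => x y /existsP[f /andP[Tf xy]]; apply/connect1/existsP.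
      by exists f; rewrite !inE Tf orbT.
    have to_u x : x \in w |: VT -> connect (adjacent (e |: ET)) x u.
      rewrite !inE => /predU1P[->|xT]; last exact/sub_conn/connT.
      have := @edge_connect _ (e |: ET) e (~~ b); rewrite negbK w_eq u_eq; apply.
    by rewrite !inE eqxx.
    move=> x y xT yT; apply: connect_trans (to_u x xT) _.
    by rewrite adjacent_connect_sym to_u.
  (* A circuit through [e] enters and leaves [w]. Only [e] is incident with [w] and no edge is
     repeated, so [e] would be a loop at [w], although its end [u] is in the tree. *)
  + move=> s circ_s Ts; have [s0 cyc_s uniq_e uniq_v] := circ_s.
    have fst_inj x y : x \in s -> y \in s -> x.1 = y.1 -> x = y.
      by move=> sx sy; exact: (uniq_map_inj uniq_e sx sy).
    have incident x b' : x \in s -> edge_end x.1 b' = w -> x.1 = e.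
      move=> /Ts; rewrite !inE => /predU1P[//|/(subT _ b') + x_eq].
      by rewrite x_eq (negPf wT).
    have [s_e|] := boolP (e \in map fst s); last first.
      move=> nes; apply: (acT s circ_s) => x sx; move: (Ts x sx).
      by rewrite !inE => /predU1P[xe|//]; rewrite -xe map_f in nes.
    have [y sy yw] : exists2 y, y \in s & source y = w.
      have /mapP[[f b'] /= sx ef] := s_e; subst f.
      have [bb|bb] : b' = ~~ b \/ b' = b by case: (b); case: (b'); auto.
        by exists (e, b'); rewrite // /source bb.
      exists (next s (e, b')); first by rewrite mem_next.
      by have /eqP <- := next_cycle cyc_s sx; rewrite /target bb.
    have sz : prev s y \in s by rewrite mem_prev.
    have zw : target (prev s y) = w by rewrite (eqP (prev_cycle cyc_s sy)).
    have ye := incident _ _ sy yw; have ze := incident _ _ sz zw.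
    have yz := fst_inj _ _ sz sy (etrans ze (esym ye)).
    have bw : edge_end e b = w.
      by move: yw zw; rewrite yz /source /target ye; case: y.2; case: (b).
    by rewrite -bw u_eq uT in wT.
- exact: finset.subsetUr.
- exact: finset.subsetUr.
- by move/setP/(_ w); rewrite !inE eqxx (negPf wT).
Qed.

Lemma spanning_connect u v : connect (adjacent ET) u v.
Proof.
by case: T_max => -[_ _ connT _] _; apply: connT; rewrite maximal_subtree_spans finset.in_setT.
Qed.

Lemma spanning_acyclic : is_acyclic ET.
Proof. by case: T_max => -[]. Qed.

End SpanningTree.

(** * Reduced paths and normal forms *)

Section ReducedPaths.
Variables (Gamma : graph) (lam : labeling Gamma).
Variables (VT : {set vertex Gamma}) (ET : {set edge Gamma}).
Hypothesis Gamma_connected : connected_graph Gamma.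
Hypothesis T_max : maximal_subtree VT ET.

Notation V := (vertex Gamma).
Notation E := (edge Gamma).
Notation G := (gbs_group lam ET).
Notation a_ := (gbs_vertex lam ET).
Implicit Types (x y z : E * bool) (g h : G) (k l : int).

Definition label x : int := lam x.1 x.2.
Definition reverse x : E * bool := (x.1, ~~ x.2).

Lemma reverseK : involutive reverse.
Proof. by case=> e b; rewrite /reverse negbK. Qed.

Lemma reverse_neq x : reverse x <> x.
Proof. by case: x => e [] []. Qed.

Lemma source_reverse x : source (reverse x) = target x.
Proof. by []. Qed.

Lemma target_reverse x : target (reverse x) = source x.
Proof. by rewrite /target negbK. Qed.

(* The generator t_e, with the convention t_e = 1 for the edges of the tree. *)
Definition stable_letter (e : E) : G :=
  if insub e is Some f then letter (gbs_rel lam (ET := ET)) (inr f) else 1.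

Definition crossing x : G := if x.2 then stable_letter x.1 else (stable_letter x.1)^-1.

Lemma crossing_reverse x : crossing (reverse x) = (crossing x)^-1.
Proof. by rewrite /crossing /=; case: x.2; rewrite ?invgK. Qed.

Lemma crossing_tree x : x.1 \in ET -> crossing x = 1.
Proof.
rewrite /crossing /stable_letter => xT; rewrite insubF ?invg1 ?if_same //.
by rewrite xT.
Qed.

Lemma stable_rel e : expgz (a_ (edge_end e true)) (lam e true) * stable_letter e
  = stable_letter e * expgz (a_ (edge_end e false)) (lam e false).
Proof.
rewrite -!class_pow /stable_letter; case: insubP => [f nT <-|]; last first.
  rewrite negbK => eT; rewrite mulg1 mul1g.
  exact/class_ofP/pres_rel/gbs_rel_tree.
apply: (mulgI (letter (gbs_rel lam (ET := ET)) (inr f))^-1); rewrite mulKg.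
have := pres_rel (gbs_rel_stable lam f).
by move/class_ofP; rewrite !class_cat class_inv.
Qed.

Lemma crossing_rel x l : expgz (a_ (source x)) (label x * l)%R * crossing x
  = crossing x * expgz (a_ (target x)) (label (reverse x) * l)%R.
Proof.
have conj_stable e m : expgz (a_ (edge_end e true)) (lam e true * m)%R ^ stable_letter e
    = expgz (a_ (edge_end e false)) (lam e false * m)%R.
  by rewrite !expgzM -expgz_conj conjgE stable_rel mulKg.
case: x => e [] /=; rewrite /crossing /source /target /label /=.
  by rewrite -(conj_stable e l) conjgE mulVKg.
by rewrite -(conj_stable e l) conjgE -mulgA mulgK.
Qed.

Lemma gbs_ind (P : G -> Prop) : P 1 -> (forall v k g, P g -> P (expgz (a_ v) k * g)) ->
  (forall x g, P g -> P (crossing x * g)) -> forall g, P g.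
Proof.
move=> P1 PV PE; apply: presented_ind => // -[v|f] g Pg.
- by have := PV v 1%R g Pg; rewrite /= expg1.
- have := PE (val f, true) g Pg; rewrite /crossing /stable_letter /=.
  by rewrite insubT ?(valP f) // => nT; rewrite (_ : Sub _ _ = f) //; exact: val_inj.
- by have := PV v (-1)%R g Pg; rewrite /= expg1.
- have := PE (val f, false) g Pg; rewrite /crossing /stable_letter /=.
  by rewrite insubT ?(valP f) // => nT; rewrite (_ : Sub _ _ = f) //; exact: val_inj.
Qed.

(** The universal property of [G], uniform over all edges: with [S] trivial on the tree, both kinds
    of defining relations take the same shape. *)
Lemma gbs_lift (K : groupType) (A : V -> K) (S : E -> K) :
  (forall e, e \in ET -> S e = 1) ->
  (forall e, expgz (A (edge_end e true)) (lam e true) * S e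
             = S e * expgz (A (edge_end e false)) (lam e false)) ->
  exists F : {multiplicative G -> K},
    (forall v, F (a_ v) = A v) /\ (forall e, F (stable_letter e) = S e).
Proof.
move=> ST relS.
pose f (s : gbs_gen ET) : K := match s with inl v => A v | inr e => S (val e) end.
have fR u v : gbs_rel lam u v -> word_val f u = word_val f v.
  case=> [e eT|e]; rewrite ?word_val_cat !word_val_pow.
    by have := relS e; rewrite ST // mulg1 mul1g.
  by rewrite word_val_inv /= mulg1 relS mulKg.
exists (pres_lift fR : {multiplicative G -> K}); split=> [v|e]; first exact: pres_lift_letter.
rewrite /stable_letter; case: insubP => [g _ <-|]; first exact: pres_lift_letter.
by rewrite negbK => eT; rewrite ST // mult1.
Qed.



Definition divides k l := exists j, (l = k * j)%R.

(** The value of a path with first edge [x] and last edge [z], vertex powers being inserted only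
    between consecutive edges. Non-divisibility by the label says that a backtrack happens at a
    power outside the edge group. *)
Inductive reduced_path : E * bool -> E * bool -> G -> Prop :=
  | reduced_path1 x : reduced_path x x (crossing x)
  | reduced_pathS x k y z g : reduced_path y z g -> source y = target x ->
      (y = reverse x -> ~ divides (label y) k) ->
      reduced_path x z (crossing x * expgz (a_ (target x)) k * g).

Lemma reduced_path_cat x y z w g h k :
  reduced_path x y g -> reduced_path z w h -> source z = target y ->
  (z = reverse y -> ~ divides (label z) k) ->
  reduced_path x w (g * expgz (a_ (target y)) k * h).
Proof.
move=> xy zw zy nd; elim: xy zy nd => [x'|x' l y' z' g' _ IH y'x' red] zy nd.
  exact: (reduced_pathS zw).
rewrite -[_ * g' * _]mulgA -[_ * (g' * _) * _]mulgA.
exact: (reduced_pathS (IH zy nd)).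
Qed.

Lemma divides_opp k l : divides k (- l)%R <-> divides k l.
Proof.
by split=> -[j /eqP]; rewrite ?eqr_oppLR -?mulrN => /eqP ->; [exists (- j)%R|exists (- j)%R; ring].
Qed.

Lemma reduced_path_inv x y g :
  reduced_path x y g -> reduced_path (reverse y) (reverse x) g^-1.
Proof.
elim=> [z|z k y' z' h _ IH y'z red].
  by rewrite -crossing_reverse; exact: reduced_path1.
rewrite !invgM mulgA -crossing_reverse -expgzN -y'z -target_reverse.
apply: reduced_path_cat => //; first exact: reduced_path1.
  by rewrite source_reverse target_reverse.
by rewrite reverseK => zy' /divides_opp; apply: contra_not (red (esym zy')); rewrite zy'.
Qed.

Lemma crossing_divides x k : divides (label (reverse x)) k ->
  exists l, crossing x * expgz (a_ (target x)) k = expgz (a_ (source x)) l * crossing x.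
Proof. by move=> [j ->]; exists (label x * j)%R; rewrite crossing_rel. Qed.

Definition in_normal_form (u v : V) g : Prop :=
  (u = v /\ exists k, g = expgz (a_ u) k) \/
  exists x y h j k, [/\ reduced_path x y h, source x = u, target y = v
                      & g = expgz (a_ u) j * h * expgz (a_ v) k].

Lemma normal_form_expgz u v k g :
  in_normal_form u v g -> in_normal_form u v (expgz (a_ u) k * g).
Proof.
case=> [[<- [l ->]]|[x [y [h [j [l [red xu yv ->]]]]]]].
  by left; split=> //; exists (k + l)%R; rewrite expgzD.
by right; exists x, y, h, (k + j)%R, l; split; rewrite // expgzD !mulgA.
Qed.

(** Prepending [z] keeps the path reduced unless it creates a backtrack through the edge group; then
    the power is carried across the edge and the two crossings cancel. *)
Lemma normal_form_crossing z v g :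
  in_normal_form (target z) v g -> in_normal_form (source z) v (crossing z * g).
Proof.
case=> [[<- [l ->]]|[x [y [h [j [l [red xz yv ->]]]]]]].
  right; exists z, z, (crossing z), 0%R, l; split=> //; first exact: reduced_path1.
  by rewrite mul1g.
have [x_eq|nx] := pselect (x = reverse z); last first.
  right; exists z, y, (crossing z * expgz (a_ (target z)) j * h), 0%R, l.
  split=> //; last by rewrite mul1g !mulgA.
  exact: (reduced_pathS red).
have [dvd|ndvd] := pselect (divides (label x) j); last first.
  right; exists z, y, (crossing z * expgz (a_ (target z)) j * h), 0%R, l.
  split=> //; last by rewrite mul1g !mulgA.
  exact: (reduced_pathS red).
rewrite x_eq in dvd; have [j' Dj'] := crossing_divides dvd.
case: red x_eq xz yv => [x' -> _ <-|x' k y' z' h' red y'x' _ x'_eq _ z'v].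
  rewrite target_reverse crossing_reverse; left; split=> //; exists (j' + l)%R.
  by rewrite expgzD !mulgA Dj' mulgK.
subst x'; right; exists y', z', h', (j' + k)%R, l; split=> //.
  by rewrite y'x' target_reverse.
by rewrite target_reverse crossing_reverse expgzD !mulgA Dj' mulgK.
Qed.

(** Crossings of tree edges are trivial, so the base vertex moves along the tree without changing
    the element. *)
Lemma normal_form_tree u w v g :
  connect (adjacent ET) u w -> in_normal_form w v g -> in_normal_form u v g.
Proof.
move=> /connectP[p]; elim: p u => [|u' p IHp] u /= => [_ -> //|].
move=> /andP[/existsP[e /andP[Te /existsP[b /andP[/eqP <- /eqP u'_eq]]]]] up w_eq nf.
have := @normal_form_crossing (e, b) v g; rewrite crossing_tree // mul1g; apply.
by rewrite /target u'_eq; exact: IHp.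
Qed.

Lemma normal_form v g : in_normal_form v v g.
Proof.
have sc := spanning_connect Gamma_connected T_max.
elim/gbs_ind: g => [|w k g IHg|x g IHg].
- by left; split=> //; exists 0%R.
- apply: normal_form_tree (sc v w) _; apply: normal_form_expgz.
  exact: normal_form_tree (sc w v) _.
- apply: normal_form_tree (sc v (source x)) _; apply: normal_form_crossing.
  exact: normal_form_tree (sc _ v) _.
Qed.

Lemma elliptic_crossing x k :
  (exists l, expgz (a_ (target x)) k ^ (crossing x)^-1 = expgz (a_ (source x)) l) \/
  reduced_path x (reverse x) (expgz (a_ (target x)) k ^ (crossing x)^-1).
Proof.
have [[j ->]|nd] := pselect (divides (label (reverse x)) k).
  by left; exists (label x * j)%R; rewrite conjgE invgK mulgA -crossing_rel mulgK.
right; rewrite conjgE invgK mulgA -crossing_reverse.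
by apply: reduced_path_cat; first exact: reduced_path1; first exact: reduced_path1.
Qed.

Lemma reduced_path_conj x y z g k :
  reduced_path y z g -> source y = target x -> target z = source y ->
  (y = reverse x -> ~ divides (label y) k) ->
  (z = x -> ~ divides (label (reverse z)) (- k)%R) ->
  reduced_path x (reverse x) (g ^ (crossing x * expgz (a_ (target x)) k)^-1).
Proof.
move=> yz yx zy nd1 nd2.
rewrite conjgE invgK invgM -expgzN -crossing_reverse mulgA.
rewrite mulgA; have := @reduced_path_cat _ _ _ _ _ (crossing (reverse x)) (- k)%R
  (reduced_pathS yz yx nd1) (reduced_path1 _).
rewrite -yx -zy; apply => //; first by rewrite zy yx.
by move=> xz; rewrite xz; apply: nd2; apply: (can_inj reverseK).
Qed.

(** The power is carried back along the path, edge by edge. Once it misses an edge group, the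
    out-and-back path is reduced and remains so when earlier edges are added on both sides. *)
Lemma elliptic_path x y g k : reduced_path x y g ->
  (exists l, expgz (a_ (target y)) k ^ g^-1 = expgz (a_ (source x)) l) \/
  reduced_path x (reverse x) (expgz (a_ (target y)) k ^ g^-1).
Proof.
elim=> {x y g} [x|x l y z g yz IH yx red]; first exact: elliptic_crossing.
rewrite invgM conjgM; case: IH => [[j ->]|yy].
  rewrite invgM yx conjgM (_ : _ ^ (expgz _ l)^-1 = expgz (a_ (target x)) j).
    exact: elliptic_crossing.
  by apply/conjg_fixP/commgP/commuteV/commute_expgz2.
by right; apply: (reduced_path_conj yy yx _ red); rewrite ?target_reverse // => yx';
  rewrite reverseK => /divides_opp; apply: red; rewrite -yx' reverseK.
Qed.

End ReducedPaths.

(** * Britton's lemma *)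

Section Detection.
Variables (Gamma : graph) (lam : labeling Gamma).
Variables (VT : {set vertex Gamma}) (ET : {set edge Gamma}).
Hypothesis T_max : maximal_subtree VT ET.

Notation V := (vertex Gamma).
Notation E := (edge Gamma).
Notation G := (gbs_group lam ET).
Notation a_ := (gbs_vertex lam ET).
Notation cross := (crossing lam ET).
Implicit Types (x y z : E * bool) (g h : G) (k l : int).

Variables (Q : groupType) (theta : {multiplicative G -> Q}).
Hypothesis theta_faithful : forall x k l,
  theta (expgz (a_ (source x)) k) = theta (expgz (a_ (source x)) (label lam x * l)%R) ->
  divides (label lam x) k.

Definition edge_image x : set Q := fun c =>
  exists l, c = theta (expgz (a_ (edge_end x.1 true)) (lam x.1 true * l)%R).

Lemma edge_image1 x : edge_image x 1.
Proof. by exists 0%R; rewrite mulr0 mult1. Qed.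

Lemma edge_imageF x c d : edge_image x c -> edge_image x d -> edge_image x (c * d^-1).
Proof.
move=> [k ->] [l ->]; exists (k - l)%R.
by rewrite mulrBr expgzD expgzN gmulfM multV.
Qed.

(** The letters of a crossing sit at the end e(1), where [edge_image] is taken: the image of the
    stable letter follows them in the positive direction and precedes them in the negative one. *)
Definition pre x : Q := if x.2 then 1 else theta (cross x).
Definition post x : Q := if x.2 then theta (cross x) else 1.

Section Theta.
Variables (K : groupType) (D : {multiplicative Q -> K}) (B : E * bool -> K).
Hypothesis BC : forall x c, edge_image x c -> commute (D c) (B x).

(* Each edge carries two letters: a path running twice through the same edge in the
   same direction then never repeats a letter. *)
Definition bump x : K :=
  (if x.2 then B x else (B x)^-1) * (if x.2 then B (reverse x) else (B (reverse x))^-1).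

(* The conjugators u v are a potential making the crossings of the tree edges trivial. *)
Definition twisted (u : V -> K) (F : G -> K) : Prop :=
  (forall v, F (a_ v) = u v * D (theta (a_ v)) * (u v)^-1) /\
  (forall x, F (cross x) = u (source x) * D (pre x) * bump x * D (post x) * (u (target x))^-1).

(** The bumps commute with the images of the edge groups, so inserting them into the crossings
    preserves the defining relations; [group_potential] provides the conjugators. *)
Lemma twisted_exists : exists (u : V -> K) (F : {multiplicative G -> K}), twisted u F.
Proof.
have [u uT] := group_potential (fun e => bump (e, true)) (spanning_acyclic T_max).
pose A v := u v * D (theta (a_ v)) * (u v)^-1.
pose S e := u (edge_end e true) * bump (e, true) * D (theta (stable_letter lam ET e))
  * (u (edge_end e false))^-1.
have expA v k : expgz (A v) k = u v * D (theta (expgz (a_ v) k)) * (u v)^-1.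
  have -> : A v = D (theta (a_ v)) ^ (u v)^-1 by rewrite conjgE invgK mulgA.
  by rewrite expgz_conj conjgE invgK mulgA !mult_expgz.
have [||F [FA FS]] := @gbs_lift _ lam ET _ A S.
- move=> e eT; have := @crossing_tree _ lam ET (e, true) eT.
  by rewrite /crossing /S /= => ->; rewrite !mult1 mulg1 uT // mulgV.
- move=> e; rewrite !expA /S.
  have comm : commute (D (theta (expgz (a_ (edge_end e true)) (lam e true)))) (bump (e, true)).
    have eC b : edge_image (e, b) (theta (expgz (a_ (edge_end e true)) (lam e true))).
      by exists 1%R; rewrite mulr1.
    by rewrite /bump /=; apply: commuteM; apply: BC; exact: eC.
  move: (bump _) comm => w comm.
  rewrite !mulgA mulgVK mulgVK -[X in X * _ * _ = _]mulgA comm mulgA.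
  rewrite -[X in X * _ = _]mulgA -gmulfM -gmulfM stable_rel.
  by rewrite !gmulfM !mulgA.
exists u, F; split=> // -[e []]; rewrite /crossing /pre /post /source /target /=.
  by rewrite FS mult1 mulg1.
rewrite multV FS /S !invgM invgK mult1 mulg1 -multV /bump /= ?invgM /crossing /=.
by rewrite !multV !mulgA.
Qed.

End Theta.


(** A crossing of [x] contributes the letters [x] and [reverse x], so equal neighbours occur only at
    backtracks. There [theta_faithful] keeps the element in between out of the edge image. *)
Lemma reduced_path_alternating x y g : reduced_path x y g ->
  exists (m : alternating Q (E * bool)%type) (q : Q),
    alt_reduced edge_image ((pre x, x, x.2) :: m) /\
    forall (K : groupType) (D : {multiplicative Q -> K}) (B : E * bool -> K) u
        (F : {multiplicative G -> K}), twisted D B u F ->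
      F g = u (source x) * (alt_val D B ((pre x, x, x.2) :: m) * D q) * (u (target y))^-1.
Proof.
elim=> {x y g} [x|x k y z g _ [m [q [red Fg]]] yx nd].
  exists [:: (1, reverse x, x.2)], (post x); split=> [|K D B u F [_ Fc]].
    by split=> //= /esym/reverse_neq.
  by rewrite Fc /bump /= !mult1 mulg1 mul1g !mulgA.
exists ((1, reverse x, x.2) :: (post x * theta (expgz (a_ (target x)) k) * pre y, y, y.2) :: m), q.
split=> [|K D B u F tw].
  split; first by move=> /esym/reverse_neq.
  split; last by case: red.
  move=> /= /esym yrx [l Cq]; apply: (nd yrx); rewrite yrx in Cq *.
  apply: (theta_faithful (l := l)); rewrite source_reverse.
  have -> : theta (expgz (a_ (target x)) (label lam (reverse x) * l)%R)
      = theta (expgz (a_ (source x)) (label lam x * l)%R) ^ theta (cross x).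
    by rewrite -multJ conjgE crossing_rel mulKg.
  move: x Cq {nd yx yrx} => [e []]; rewrite /pre /post /source /target /label /=.
    rewrite crossing_reverse multV => <-.
    by rewrite conjgE !mulgA mulVg mul1g mulgVK.
  rewrite mul1g mulg1 => ->; rewrite -multJ conjgE.
  by have := crossing_rel lam ET (e, false) l; rewrite /source /target /label /= => ->; rewrite mulKg.
rewrite !gmulfM (Fg _ _ _ _ _ tw); case: tw => FA ->.
have -> : F (expgz (a_ (target x)) k)
  = u (target x) * D (theta (expgz (a_ (target x)) k)) * (u (target x))^-1.
  rewrite mult_expgz FA; have -> w : u w * D (theta (a_ w)) * (u w)^-1 = D (theta (a_ w)) ^ (u w)^-1.
    by rewrite conjgE invgK mulgA.
  by rewrite expgz_conj conjgE invgK mulgA !mult_expgz.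
by rewrite yx /bump /= !gmulfM !mult1 mul1g !mulgA mulgVK mulgVK.
Qed.

(** The product [m] is fixed before [K] and [B], so that transvections adapted to [m] may be taken
    for [B]. As the path is closed, the end conjugators form a conjugation and disappear. *)
Lemma reduced_path_detect x y g k : reduced_path x y g -> source x = target y ->
  exists (m : alternating Q (E * bool)%type) (q : Q), [/\ m <> [::], alt_reduced edge_image m &
    forall (K : groupType) (D : {multiplicative Q -> K}) (B : E * bool -> K),
      (forall x c, edge_image x c -> commute (D c) (B x)) ->
      exists F : {multiplicative G -> K},
        F (g * expgz (a_ (source x)) k) = 1 -> alt_val D B m * D q = 1].
Proof.
move=> /reduced_path_alternating[m [q [red Fg]]] xy.
exists ((pre x, x, x.2) :: m), (q * theta (expgz (a_ (source x)) k)); split=> // K D B BC.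
have [u [F tw]] := twisted_exists BC; exists F.
rewrite gmulfM (Fg _ _ _ _ _ tw) mult_expgz; case: tw => -> _.
have -> w : u w * D (theta (a_ w)) * (u w)^-1 = D (theta (a_ w)) ^ (u w)^-1.
  by rewrite conjgE invgK mulgA.
rewrite expgz_conj conjgE invgK xy -!mult_expgz gmulfM.
move: (alt_val _ _ _) => w Fg1; apply/eqP; rewrite -(conjg_eq1 _ (u (target y))^-1).
by rewrite conjgE invgK -Fg1 !mulgA mulgVK.
Qed.


End Detection.

(** * Shifts of layered functions *)

Section LayerBijections.
Variables (Q : groupType) (T : Type) (I : Type).

Definition layer_shift (q : Q) (v : I * Q -> T) : I * Q -> T := fun i => v (i.1, i.2 * q).

Lemma layer_shiftK q : cancel (layer_shift q) (layer_shift q^-1).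
Proof. by move=> v; apply/funext => -[i x]; rewrite /layer_shift /= mulgVK. Qed.

Lemma layer_shiftVK q : cancel (layer_shift q^-1) (layer_shift q).
Proof. by move=> v; apply/funext => -[i x]; rewrite /layer_shift /= mulgK. Qed.

Definition shift_bijection q : bijection (I * Q -> T) :=
  Bijection (layer_shiftK q) (layer_shiftVK q).

Lemma shift_bijectionM : {morph shift_bijection : q r / q * r}.
Proof.
by move=> q r; apply: bijectionP => v; apply/funext => i; rewrite /= /layer_shift mulgA.
Qed.

HB.instance Definition _ :=
  isMultiplicative.Build Q (bijection (I * Q -> T)) shift_bijection shift_bijectionM.

End LayerBijections.

Lemma shift_transvection (Q : groupType) (Y : eqType) (C : Y -> set Q)
  (C1 : forall y, C y 1) (CF : forall y c d, C y c -> C y d -> C y (c * d^-1))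
  (F : fieldType) L m y c (a : F) (v : 'I_L.+1 * Q -> F) : C y c ->
  layer_shift c (transvection C m a y v) = transvection C m a y (layer_shift c v).
Proof.
by move=> Cc; apply/funext => -[l x]; rewrite /layer_shift /transvection /= alt_selC.
Qed.

(** * The translation representation and the modular homomorphism *)

Section TranslationRepresentation.
Variables (Gamma : graph) (lam : labeling Gamma).
Variable ET : {set edge Gamma}.
Hypothesis lam_neq0 : forall e b, lam e b <> 0%R.

Notation V := (vertex Gamma).
Notation E := (edge Gamma).
Notation G := (gbs_group lam ET).
Notation a_ := (gbs_vertex lam ET).
Implicit Types (x y z : E * bool) (g h : G) (k l : int).

Variable c : V -> int.
Hypothesis c_neq0 : forall v, c v <> 0%R.
Hypothesis c_tree : forall e, e \in ET ->
  (lam e true * c (edge_end e true) = lam e false * c (edge_end e false))%R.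

(** The factor by which [t_e] must dilate for its relation to hold between translations; it is 1 on
    the tree by [c_tree]. *)
Definition edge_slope e : rat :=
  ((lam e true * c (edge_end e true))%:~R / (lam e false * c (edge_end e false))%:~R)%R.

Lemma lam_c_neq0 e b : ((lam e b * c (edge_end e b))%:~R : rat) != 0%R.
Proof. by rewrite intr_eq0 mulf_eq0; apply/norP; split; apply/eqP. Qed.

Lemma edge_slope_neq0 e : edge_slope e != 0%R.
Proof. by rewrite /edge_slope mulf_neq0 ?invr_eq0 ?lam_c_neq0. Qed.

Definition translation (t : rat) : bijection rat := @Bijection _ (+%R t) (+%R (- t)%R) (addKr t) (addNKr t).
Definition dilation (s : rat) (s0 : s != 0%R) : bijection rat :=
  Bijection (mulKf s0) (mulVKf s0).

Lemma expgz_translation t k : expgz (translation t) k = translation (t * k%:~R)%R.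
Proof.
have aux t' n : translation t' ^+ n = translation (t' * n%:R)%R.
  elim: n => [|n IHn]; apply: bijectionP => r /=; first by rewrite mulr0 add0r.
  by rewrite expgS IHn /= -addn1 natrD mulrDr mulr1 addrA [(t' + _)%R]addrC.
case: k => n; rewrite /= aux //; apply: bijectionP => r /=.
by rewrite NegzE mulrNz mulrN.
Qed.

Lemma translation_representation : exists (phi : {multiplicative G -> bijection rat})
    (slope : G -> rat),
  [/\ forall v, phi (a_ v) = translation (c v)%:~R,
      forall e, slope (stable_letter lam ET e) = edge_slope e,
      forall g, slope g <> 0%R &
      forall g (r s : rat), (phi g r - phi g s = slope g * (r - s))%R].
Proof.
have [||phi [phiV phiE]] := @gbs_lift _ lam ET (bijection rat)
  (fun v => translation (c v)%:~R) (fun e => dilation (edge_slope_neq0 e)).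
- move=> e eT; apply: bijectionP => r /=; rewrite /edge_slope c_tree //.
  by rewrite divff ?lam_c_neq0 // mul1r.
- move=> e; rewrite !expgz_translation; apply: bijectionP => r /=.
  rewrite mulrDr; congr (_ + _)%R; rewrite /edge_slope -!intrM ![(c _ * _)%R]mulrC.
  by rewrite mulfVK // lam_c_neq0.
pose affine (d : rat) g := forall r s : rat, (phi g r - phi g s = d * (r - s))%R.
have affineM d d' g h : affine d g -> affine d' h -> affine (d * d')%R (g * h).
  by move=> dg d'h r s; rewrite gmulfM /= dg d'h mulrA.
have affineV d g : d != 0%R -> affine d g -> affine d^-1%R g^-1.
  move=> d0 dg r s; rewrite multV; apply: (mulfI d0).
  by rewrite -dg mulVKf // /= !bij_invK.
have ex g : exists2 d, d != 0%R & affine d g.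
  elim/gbs_ind: g => [|v k g [d d0 dg]|x g [d d0 dg]].
  - by exists 1%R; rewrite // => r s; rewrite mult1 mul1r.
  - exists d => //; rewrite -[d]mul1r; apply: affineM dg => r s.
    by rewrite mult_expgz phiV expgz_translation /=; ring.
  - have slope_x : affine (edge_slope x.1) (stable_letter lam ET x.1).
      by move=> r s; rewrite phiE /=; ring.
    exists ((if x.2 then edge_slope x.1 else (edge_slope x.1)^-1) * d)%R.
      by rewrite mulf_neq0 //; case: x.2; rewrite ?invr_eq0 ?edge_slope_neq0.
    apply: affineM dg; rewrite /crossing; case: x.2 => //.
    by apply: affineV => //; exact: edge_slope_neq0.
exists phi, (fun g => phi g 1 - phi g 0)%R; split=> //.
- by move=> e; rewrite phiE /= mulr1 mulr0 subr0.
- by move=> g; have [d d0 ->] := ex g; rewrite subr0 mulr1; apply/eqP.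
- by move=> g r s; have [d d0 dg] := ex g; rewrite !dg subr0 mulr1.
Qed.

End TranslationRepresentation.

(** * Commensurability of elliptic elements, and Delta as the inverse slope *)

Section Commensurability.
Implicit Type G : groupType.

Definition commensurable G (x y : G) : Prop :=
  exists m n : int, [/\ m <> 0%R, n <> 0%R & expgz x m = expgz y n].

Lemma commensurable_refl G (x : G) : commensurable x x.
Proof. by exists 1%R, 1%R. Qed.

Lemma commensurable_sym G (x y : G) : commensurable x y -> commensurable y x.
Proof. by case=> m [n [m0 n0 xy]]; exists n, m. Qed.

Lemma mulz_neq0 (m n : int) : m <> 0%R -> n <> 0%R -> (m * n)%R <> 0%R.
Proof. by move=> /eqP m0 /eqP n0; apply/eqP; rewrite mulf_neq0. Qed.

Lemma commensurable_trans G (x y z : G) :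
  commensurable x y -> commensurable y z -> commensurable x z.
Proof.
case=> m [n [m0 n0 xy]] [k [l [k0 l0 yz]]].
exists (m * k)%R, (l * n)%R; split; try exact: mulz_neq0.
by rewrite expgzM xy -expgzM mulrC !expgzM yz.
Qed.

Lemma commensurable_conj G (x y z : G) : commensurable x y -> commensurable (x ^ z) (y ^ z).
Proof. by case=> m [n [m0 n0 xy]]; exists m, n; rewrite !expgz_conj xy. Qed.

End Commensurability.

Section VertexElements.
Variables (Gamma : graph) (lam : labeling Gamma).
Variables (VT : {set vertex Gamma}) (ET : {set edge Gamma}).
Hypothesis Gamma_connected : connected_graph Gamma.
Hypothesis T_max : maximal_subtree VT ET.
Hypothesis lam_neq0 : forall e b, lam e b <> 0%R.

Notation V := (vertex Gamma).
Notation E := (edge Gamma).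
Notation G := (gbs_group lam ET).
Notation a_ := (gbs_vertex lam ET).
Notation cross := (crossing lam ET).
Implicit Types (x y z : E * bool) (g h : G) (k l : int).

Lemma commensurable_crossing x : commensurable (a_ (source x) ^ cross x) (a_ (target x)).
Proof.
exists (label lam x), (label lam (reverse x)); split; try exact: lam_neq0.
have := crossing_rel lam ET x 1%R; rewrite !mulr1 expgz_conj conjgE => ->.
by rewrite mulKg.
Qed.

Lemma commensurable_vertices u v : commensurable (a_ u) (a_ v).
Proof.
have /connectP[p] := spanning_connect Gamma_connected T_max u v.
elim: p u => [|u' p IHp] u /= => [_ ->|]; first exact: commensurable_refl.
move=> /andP[/existsP[e /andP[Te /existsP[b /andP[/eqP <- /eqP u'_eq]]]]] up v_eq.
apply: commensurable_trans (IHp _ up v_eq); rewrite -u'_eq.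
by have := commensurable_crossing (e, b); rewrite crossing_tree // conjg1.
Qed.

(** Induction on [g] for all [u] at once: a vertex power centralizes its generator, and a crossing
    takes the generator of its source to an element commensurable with that of its target. *)
Lemma commensurable_elliptic u v g : commensurable (a_ u ^ g) (a_ v).
Proof.
elim/gbs_ind: g u => [|w k g IHg|x g IHg] u.
- by rewrite conjg1; exact: commensurable_vertices.
- rewrite conjgM; apply: commensurable_trans (IHg w); apply: commensurable_conj.
  have fix_w : a_ w ^ expgz (a_ w) k = a_ w.
    by apply/conjg_fixP/commgP/commute_expgz.
  rewrite -[X in commensurable _ X]fix_w.
  exact/commensurable_conj/commensurable_vertices.
- rewrite conjgM; apply: commensurable_trans (IHg (target x)); apply: commensurable_conj.
  apply: commensurable_trans (commensurable_crossing x).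
  exact/commensurable_conj/commensurable_vertices.
Qed.

Variables (c : V -> int) (phi : {multiplicative G -> bijection rat}) (slope : G -> rat).
Hypothesis c_neq0 : forall v, c v <> 0%R.
Hypothesis phi_vertex : forall v, phi (a_ v) = translation (c v)%:~R.
Hypothesis slope_neq0 : forall g, slope g <> 0%R.
Hypothesis phi_slope : forall g (r s : rat), (phi g r - phi g s = slope g * (r - s))%R.

Lemma phi_expgz v k : phi (expgz (a_ v) k) = translation (c v * k)%:~R.
Proof. by rewrite mult_expgz phi_vertex expgz_translation intrM. Qed.

Lemma translation_inj : injective translation.
Proof. by move=> r s /(congr1 (fun f : bijection rat => f 0%R)) /=; rewrite !addr0. Qed.

Lemma vertex_expgz_inj v k l : expgz (a_ v) k = expgz (a_ v) l -> k = l.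
Proof.
move/(congr1 phi); rewrite !phi_expgz => /translation_inj/eqP.
by rewrite eqr_int => /eqP/(mulfI (introN eqP (@c_neq0 v))).
Qed.

Lemma slopeM g h : slope (g * h) = (slope g * slope h)%R.
Proof.
have := phi_slope (g * h) 1 0; rewrite gmulfM /= phi_slope phi_slope subr0 !mulr1.
by move->.
Qed.

Lemma slope1 : slope 1 = 1%R.
Proof. by have := phi_slope 1 1 0; rewrite mult1 /= subr0 mulr1. Qed.

Lemma slopeV g : slope g^-1 = (slope g)^-1%R.
Proof.
apply: (mulfI (introN eqP (@slope_neq0 g))).
by rewrite -slopeM mulgV slope1 divff //; apply/eqP.
Qed.

Lemma slope_vertex v k : slope (expgz (a_ v) k) = 1%R.
Proof. by have := phi_slope (expgz (a_ v) k) 1 0; rewrite phi_expgz /= subr0 mulr1 => <-; ring. Qed.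

Lemma phi_conj g v k :
  phi (expgz (a_ v) k ^ g) = translation ((slope g)^-1 * (c v * k)%:~R)%R.
Proof.
apply: bijectionP => r; rewrite multJ phi_expgz conjgE -multV /=.
have := phi_slope g^-1 ((c v * k)%:~R + phi g r)%R (phi g r).
by rewrite addrK slopeV {2}multV /= bij_funK => <-; rewrite subrK.
Qed.

(** Conjugation by [g] divides translation lengths by [slope g]; comparing lengths in the defining
    relation gives [q]. *)
Lemma modular_slope g q : modular_value g q -> q = (slope g)^-1%R.
Proof.
case=> _ [m [n [[v [k [h ->]]] a1 m0 n0 [mn ->]]]].
have k0 : ((c v * k)%:~R != 0 :> rat)%R.
  rewrite intr_eq0 mulf_neq0 //; first exact/eqP.
  by apply/eqP => k0; apply: a1; rewrite k0 conj1g.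
move: mn; rewrite !expgz_conj -conjgM -!expgzM => /(congr1 phi).
rewrite !phi_conj slopeM => /translation_inj.
have h0 : ((slope h)^-1 != 0)%R by rewrite invr_eq0; apply/eqP.
rewrite !(mulrA (c v)) !(intrM _ (c v * k)%R) invfM -!mulrA => /(mulfI h0).
by rewrite mulrCA => /(mulfI k0) <-; rewrite mulfK // intr_eq0; apply/eqP.
Qed.

Lemma expgz_vertex_neq1 (v : V) k g : k <> 0%R -> expgz (a_ v) k ^ g <> 1.
Proof.
by move=> k0 /eqP; rewrite conjg_eq1 => /eqP kv; apply/k0/(@vertex_expgz_inj v).
Qed.

Lemma modular_exists (v : V) g : modular_value g (slope g)^-1%R.
Proof.
have [m [n [m0 n0 mn]]] := commensurable_elliptic v v g.
suff mod_mn : modular_value g (n%:~R / m%:~R)%R.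
  by rewrite -(modular_slope mod_mn).
exists (a_ v), m, n; split=> //; last by rewrite -expgz_conj.
  by exists v, 1%R, 1; rewrite conjg1 /= expg1.
by have := @expgz_vertex_neq1 v 1%R 1; rewrite conjg1 /= expg1; apply.
Qed.

Lemma DeltaE (v : V) g : Delta lam ET g = (slope g)^-1%R.
Proof.
by apply: xget_unique => [|q]; [exact: modular_exists v g|move/modular_slope].
Qed.

Lemma divides_vertex x k l :
  phi (expgz (a_ (source x)) k) = phi (expgz (a_ (source x)) (label lam x * l)%R) ->
  divides (label lam x) k.
Proof.
rewrite !phi_expgz => /translation_inj/eqP; rewrite eqr_int => /eqP.
by move/(mulfI (introN eqP (@c_neq0 _))) => ->; exists l.
Qed.

Lemma britton x y g k : reduced_path x y g -> source x = target y ->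
  g * expgz (a_ (source x)) k <> 1.
Proof.
move=> red xy.
have [m [q [m0 m_red detect]]] := reduced_path_detect T_max divides_vertex k red xy.
(* The two-element field is an arbitrary choice. *)
pose C := edge_image phi; pose F := 'F_2; pose L := size m.
pose T := 'I_L.+1 * bijection rat -> F.
have C1 z : C z 1 := edge_image1 phi z.
have CF z := @edge_imageF _ _ _ _ phi z.
pose bump z : bijection T := Bijection
  (@transvectionK _ _ C CF F L m m_red 1%R z) (@transvectionNK _ _ C CF F L m m_red 1%R z).
have [z r Cr|Phi Phi1] := detect _ (shift_bijection F 'I_L.+1) bump.
  by apply: bijectionP => v; apply: shift_transvection.
move=> g1; move: Phi1; rewrite g1 mult1 => /(_ erefl); apply: (alt_val_neq1 C1 CF m_red (erefl L) (act := @bij_fun T)) => //.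
Qed.

End VertexElements.

(** * Power relations in periodic groups *)

Section PeriodicElements.
Implicit Type G : groupType.

Lemma has_order_dvd G (x : G) n (k : int) :
  has_order x n -> expgz x k = 1 -> (n%:Z %| k)%Z.
Proof.
move=> [n_gt0 xn min_n] xk; apply/dvdz_mod0P/eqP.
have r_ge0 := modz_ge0 k (lt0n_neq0 n_gt0 : n%:Z != 0)%R.
have := ltz_pmod k (n_gt0 : (0 < n%:Z)%R).
have : expgz x (k %% n)%Z = 1.
  have := xk; rewrite {1}(divz_eq k n) expgzD.
  by rewrite mulrC expgzM expgz_nat xn expgz1 mul1g.
case: (k %% n)%Z r_ge0 => // -[|r] // _ /(min_n r.+1 isT) n_le.
by rewrite ltz_nat ltnNge n_le.
Qed.

Lemma expgz_coprime G (x : G) n (k : int) :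
  has_order x n -> coprimez n k -> exists j, x = expgz x (k * j)%R.
Proof.
move=> [_ xn _] /coprimezP[[u v] /= uv]; exists v.
have : expgz x (u * n + v * k)%R = x by rewrite uv /= expg1.
have un : expgz x (u * n)%R = 1 by rewrite mulrC expgzM expgz_nat xn expgz1.
by rewrite expgzD un mul1g mulrC.
Qed.

(* y ^ k and y ^ l have the same order, so gcd(n, k) = gcd(n, l) divides gcd(k, l). *)
Lemma coprime_order G (y g : G) n (k l : int) : has_order y n ->
  coprimez k l -> expgz y k ^ g = expgz y l -> coprimez n k /\ coprimez n l.
Proof.
have aux h (k' l' : int) : has_order y n -> coprimez k' l' ->
    expgz y k' ^ h = expgz y l' -> coprimez n k'.
  move=> ord_y kl y_kl; have [n_gt0 yn _] := ord_y.
  have /dvdzP[k1 Dk] := dvdz_gcdr n k'; have /dvdzP[n1 Dn] := dvdz_gcdl n k'.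
  have d0 : gcdz n k' != 0%R by rewrite gcdz_eq0 negb_and -lt0n n_gt0.
  have /(has_order_dvd ord_y) : expgz y (l' * n1)%R = 1.
    rewrite expgzM -y_kl expgz_conj -expgzM Dk -mulrA [(gcdz _ _ * _)%R]mulrC -Dn.
    by rewrite mulrC expgzM expgz_nat yn expgz1 conj1g.
  have n10 : n1 != 0%R.
    by apply: contraTneq n_gt0 => n10; rewrite -lez_nat Dn n10 mul0r.
  rewrite {1}Dn [(l' * _)%R]mulrC dvdz_mul2l // => d_l'.
  have := dvdz_gcdr n k'; rewrite /coprimez => d_k'.
  have : (gcdz n k' %| gcdz k' l')%Z by rewrite dvdz_gcd d_k' d_l'.
  by rewrite (eqP kl) dvdz1 /gcdz absz_nat => /eqP ->.
move=> ord_y kl y_kl; split; first exact: aux ord_y kl y_kl.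
by apply: (aux g^-1 l k ord_y); rewrite 1?coprimez_sym // -y_kl conjgK.
Qed.

(** As [n] is coprime to [k], [y] is a power of [y ^ k], so its conjugate by [g] is a power of
    [y ^ l]; this iterates. *)
Lemma conj_in_cycle G (y g : G) n (k l : int) i : has_order y n ->
  coprimez k l -> expgz y k ^ g = expgz y l -> exists j, y ^ (g ^+ i) = expgz y j.
Proof.
move=> ord_y kl y_kl; have [nk nl] := coprime_order ord_y kl y_kl.
have [j0 yj0] := expgz_coprime ord_y nk.
elim: i => [|i [j IHi]]; first by exists 1%R; rewrite conjg1 /= expg1.
exists (l * j0 * j)%R; rewrite expgSr conjgM IHi -expgz_conj {1}yj0.
by rewrite [expgz y (k * j0)%R]expgzM -expgz_conj y_kl -!expgzM mulrA.
Qed.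

End PeriodicElements.

(** * Ascending HNN extensions of cyclic groups *)

Section AscendingHNN.
Variables (G : groupType) (a s : G) (n : int).
Hypothesis as_n : a ^ s = expgz a n.
Hypothesis gen_ind : forall P : G -> Prop, P 1 -> (forall k g, P g -> P (expgz a k * g)) ->
  (forall g, P g -> P (s * g)) -> (forall g, P g -> P (s^-1 * g)) -> forall g, P g.

(** The normal closure of [a], as the union of an increasing chain of cyclic groups. *)
Definition base_roots : set G := fun g => exists (i : nat) k, g = expgz a k ^ (s ^- i).

Lemma root_lift (i j : nat) k : exists l, expgz a k ^ (s ^- i) = expgz a l ^ (s ^- (j + i)).
Proof.
elim: j => [|j [l ->]]; first by exists k.
exists (n * l)%R; rewrite addSn expgSr invgM conjgM expgzM -as_n expgz_conj.
by rewrite conjgK.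
Qed.

Lemma base_roots2 g h : base_roots g -> base_roots h -> exists i k l,
  g = expgz a k ^ (s ^- i) /\ h = expgz a l ^ (s ^- i).
Proof.
move=> [i [k ->]] [j [l ->]]; have [k' ->] := root_lift i j k.
by have [l' ->] := root_lift j i l; exists (j + i)%N, k', l'; rewrite addnC.
Qed.

Lemma base_rootsM g h : base_roots g -> base_roots h -> base_roots (g * h).
Proof.
move=> Ng /(base_roots2 Ng)[i [k [l [-> ->]]]].
by exists i, (k + l)%R; rewrite expgzD conjMg.
Qed.

Lemma base_rootsV g : base_roots g -> base_roots g^-1.
Proof. by case=> i [k ->]; exists i, (- k)%R; rewrite expgzN conjVg. Qed.

Lemma base_roots_expgz k : base_roots (expgz a k).
Proof. by exists 0%N, k; rewrite invg1 conjg1. Qed.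

Lemma base_roots_commute g h : base_roots g -> base_roots h -> commute g h.
Proof.
move=> Ng /(base_roots2 Ng)[i [k [l [-> ->]]]].
exact/commute_conj/commute_expgz2.
Qed.

Lemma base_rootsJ g : base_roots g -> base_roots (g ^ s) /\ base_roots (g ^ s^-1).
Proof.
case=> i [k ->]; split; last first.
  by exists i.+1, k; rewrite -conjgM expgS invgM.
have [l ->] := root_lift i 1 k; exists i, l.
by rewrite add1n expgS invgM conjgM conjgKV.
Qed.

Lemma base_rootsJz g j : base_roots g -> base_roots (g ^ expgz s j).
Proof.
have aux t i h : (forall h', base_roots h' -> base_roots (h' ^ t)) ->
    base_roots h -> base_roots (h ^ (t ^+ i)).
  move=> Nt Nh; elim: i => [|i IHi]; first by rewrite conjg1.
  by rewrite expgSr conjgM; exact: Nt.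
move=> Ng; case: j => i /=; last rewrite -expVgn.
  by apply: aux => // h /base_rootsJ[].
by apply: aux => // h /base_rootsJ[].
Qed.

Lemma base_roots_split g : exists m j, base_roots m /\ g = m * expgz s j.
Proof.
elim/gen_ind: g => [|k g [m [j [Nm ->]]]|g [m [j [Nm ->]]]|g [m [j [Nm ->]]]].
- by exists 1, 0%R; split; [exact: (base_roots_expgz 0%R)|rewrite mulg1].
- exists (expgz a k * m), j; rewrite mulgA; split=> //.
  exact/base_rootsM/Nm/base_roots_expgz.
- exists (m ^ s^-1), (1 + j)%R; split; first by case: (base_rootsJ Nm).
  by rewrite expgzD expgz_nat expg1 conjgE invgK !mulgA mulgVK.
- exists (m ^ s), (-1 + j)%R; split; first by case: (base_rootsJ Nm).
  by rewrite expgzD expgzN expgz_nat expg1 conjgE !mulgA mulgK.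
Qed.

(** Modulo base roots an element is a power of [s], so commutators are base roots; these commute
    with each other. *)
Lemma ascending_hnn_solvable : solvable_group G.
Proof.
have sub_der n' (A : set G) : subgroup A -> (forall x y, derived_series n' x ->
    derived_series n' y -> A [~ x, y]) -> forall z, derived_series n'.+1 z -> A z.
  move=> subA commA z; apply=> /=; split=> // _ [x [y [Dx Dy ->]]].
  exact: commA.
have der1 z : derived_series 1 z -> base_roots z.
  apply: sub_der => [|x y _ _].
    by split=> [|x y Nx Ny]; [exact: (base_roots_expgz 0%R)|exact/base_rootsM/base_rootsV].
  have [m [i [Nm ->]]] := base_roots_split x; have [m' [j [Nm' ->]]] := base_roots_split y.
  have Jz h k : expgz s k * h = h ^ expgz s (- k)%R * expgz s k.
    by rewrite conjgE expgzN invgK -!mulgA mulVg mulg1.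
  have [p [Np Dp]] : exists p, base_roots p /\
      m * expgz s i * (m' * expgz s j) = p * expgz s (i + j)%R.
    exists (m * m' ^ expgz s (- i)%R); split; last first.
      by rewrite expgzD !mulgA -[m * _ * m']mulgA Jz !mulgA.
    exact/base_rootsM/base_rootsJz.
  have [q [Nq Dq]] : exists q, base_roots q /\
      m' * expgz s j * (m * expgz s i) = q * expgz s (i + j)%R.
    exists (m' * m ^ expgz s (- j)%R); split; last first.
      by rewrite [(i + j)%R]addrC expgzD !mulgA -[m' * _ * m]mulgA Jz !mulgA.
    exact/base_rootsM/base_rootsJz.
  have -> : [~ m * expgz s i, m' * expgz s j] = (q^-1 * p) ^ expgz s (i + j)%R.
    rewrite /commg /conjg !mulgA -invgM Dq -[_ * m * _ * _ * _]mulgA.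
    by rewrite -!mulgA [m * _]mulgA Dp invgM !mulgA.
  exact/base_rootsJz/base_rootsM/Np/base_rootsV.
exists 2%N; apply/seteqP; split=> z.
  apply: sub_der => [|x y /der1 Nx /der1 Ny]; last first.
    by apply/eqP/commgP; exact: base_roots_commute.
  by split=> // x y -> ->; rewrite invg1 mulg1.
by move=> -> A [[A1 _] _].
Qed.

End AscendingHNN.

(** * Consequences of residual properties *)

Lemma bernoulli (t : rat) n : (0 <= t -> 1 + t * n%:R <= (1 + t) ^+ n)%R.
Proof.
move=> t0; elim: n => [|n IHn]; first by rewrite mulr0 addr0 expr0.
have tn : (0 <= t * n%:R)%R by rewrite mulr_ge0.
rewrite exprS; apply: le_trans (ler_wpM2l _ IHn); last by rewrite addr_ge0.
by rewrite -addn1 natrD; nra.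
Qed.

Lemma expr_unbounded (r b : rat) : (1 < r)%R -> exists n : nat, (b < r ^+ n)%R.
Proof.
move=> r1; have t0 : (0 < r - 1)%R by rewrite subr_gt0.
have [n nb] : exists n : nat, (b / (r - 1) < n%:R)%R.
  exists (Num.bound `|b / (r - 1)|)%R.
  exact: le_lt_trans (ler_norm _) (archi_boundP (normr_ge0 _)).
exists n; apply: lt_le_trans (_ : 1 + (r - 1) * n%:R <= _)%R; last first.
  by have := bernoulli n (ltW t0); rewrite [X in (_ <= X ^+ _)%R]addrC subrK.
by rewrite ltr_pdivrMr // mulrC in nb; apply: lt_trans nb _; rewrite ltrDr.
Qed.

Section ResidualConsequences.
Variables (Gamma : graph) (lam : labeling Gamma).
Variables (VT : {set vertex Gamma}) (ET : {set edge Gamma}).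
Hypothesis Gamma_connected : connected_graph Gamma.
Hypothesis T_max : maximal_subtree VT ET.
Hypothesis lam_neq0 : forall e b, lam e b <> 0%R.

Notation V := (vertex Gamma).
Notation E := (edge Gamma).
Notation G := (gbs_group lam ET).
Notation a_ := (gbs_vertex lam ET).
Notation cross := (crossing lam ET).
Notation lab := (label lam).
Implicit Types (x y z : E * bool) (g h : G) (k l : int).

Variables (c : V -> int) (phi : {multiplicative G -> bijection rat}) (slope : G -> rat).
Hypothesis c_neq0 : forall v, c v <> 0%R.
Hypothesis phi_vertex : forall v, phi (a_ v) = translation (c v)%:~R.
Hypothesis slope_stable : forall e, slope (stable_letter lam ET e) = edge_slope lam c e.
Hypothesis slope_neq0 : forall g, slope g <> 0%R.
Hypothesis phi_slope : forall g (r s : rat), (phi g r - phi g s = slope g * (r - s))%R.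

Lemma slope_crossing x :
  slope (cross x) = ((lab x * c (source x))%:~R / (lab (reverse x) * c (target x))%:~R)%R.
Proof.
have sV := slopeV slope_neq0 phi_slope.
case: x => e []; rewrite /crossing /= ?sV slope_stable //.
by rewrite /edge_slope invfM invrK mulrC.
Qed.

(** The conjugate of the generator by [g] is the value of the reversed path followed by the path,
    reduced at the junction since the label is not a unit; [britton] separates it from the
    generator. *)
Lemma reduced_path_not_commute x y g : reduced_path x y g -> target y = source x ->
  ~ divides (lab x) 1 -> ~ commute g (a_ (source x)).
Proof.
move=> red yx nd comm.
have := reduced_path_cat (k := 1) (reduced_path_inv red) red.
rewrite target_reverse reverseK => /(_ erefl (fun _ => nd)) red2.
have := britton T_max c_neq0 phi_vertex (k := (-1)%R) red2.
rewrite source_reverse yx => /(_ erefl); apply.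
by rewrite /= !expg1 -[g^-1 * _ * _]mulgA -comm mulKg mulgV.
Qed.

Variable rho : nat_pred.
Hypothesis resid : residually (@rho_group rho) G.

Lemma residual_commute g h :
  (forall (H : groupType) (f : {multiplicative G -> H}), rho_group rho H -> commute (f g) (f h)) ->
  commute g h.
Proof.
move=> comm; apply/eqP/negPn/negP => nc.
have /resid[H [f [Hrho _]]] : (g * h) * (h * g)^-1 <> 1.
  by move/divg1_eq/eqP; rewrite (negPf nc).
by apply; rewrite gmulfM multV !gmulfM comm // mulgV.
Qed.

(** In a periodic quotient the conjugate is a power of [expgz (a_ u) N], by [conj_in_cycle], hence
    of the other element. *)
Lemma elliptic_commute u w (h : G) g (k l N r : int) i :
  coprimez k l -> expgz (expgz (a_ u) N) k ^ g = expgz (expgz (a_ u) N) l ->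
  expgz (a_ u) N = expgz (a_ w ^ h) r ->
  commute (expgz (a_ u) N ^ (g ^+ i)) (a_ w ^ h).
Proof.
move=> kl kl_g Nr; apply: residual_commute => H f [periodic _].
have [n ord_n] := periodic (f (expgz (a_ u) N)).
have := conj_in_cycle i ord_n kl (g := f g); rewrite -!mult_expgz -multJ kl_g.
move=> /(_ erefl)[j]; rewrite -multX -multJ => ->.
rewrite -mult_expgz Nr -expgzM mult_expgz.
exact/commute_sym/commute_expgz.
Qed.

Lemma common_power u (Y : seq (V * G)) : exists N, N <> 0%R /\
  forall p, p \in Y -> exists r, expgz (a_ u) N = expgz (a_ p.1 ^ p.2) r.
Proof.
elim: Y => [|p Y [N [N0 NY]]]; first by exists 1%R.
have /commensurable_sym[m [n [m0 n0 mn]]] :=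
  commensurable_elliptic Gamma_connected T_max lam_neq0 p.1 u p.2.
exists (m * N)%R; split=> [|q]; first exact: mulz_neq0.
rewrite inE => /predU1P[->|/NY[r Nr]]; first by exists (n * N)%R; rewrite !expgzM mn.
by exists (r * m)%R; rewrite mulrC !expgzM Nr.
Qed.

(* The translation lengths of a power of a_u conjugated by the powers of g tend to 0,
   so that these conjugates eventually leave the cyclic group generated by a_u. *)
Lemma commuting_elliptic u g (Y : seq (V * G)) : (1 < `|slope g|)%R ->
  exists h N, (forall k, expgz (a_ u) N ^ h <> expgz (a_ u) k) /\
    forall p, p \in Y -> commute (expgz (a_ u) N ^ h) (a_ p.1 ^ p.2).
Proof.
move=> slope_g; have [N0 [N00 N0Y]] := common_power u Y.
have [m [n [m0 n0 mn]]] := commensurable_elliptic Gamma_connected T_max lam_neq0 u u g.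
have d0 : gcdz m n != 0%R by rewrite gcdz_eq0 negb_and; apply/orP; left; exact/eqP.
have [m' Dm] : exists m', m = (m' * gcdz m n)%R by apply/dvdzP; exact: dvdz_gcdl.
have [n' Dn] : exists n', n = (n' * gcdz m n)%R by apply/dvdzP; exact: dvdz_gcdr.
have m'n' : coprimez m' n'.
  have [s [t st]] := Bezoutz m n; apply/coprimezP; exists (s, t) => /=.
  apply: (mulIf d0); rewrite mul1r mulrDl -!mulrA.
  by rewrite -[X in (s * X)%R]Dm -[X in (t * X)%R]Dn.
(* [N0] gives a power common to all the tests; the factor [d] makes the exponents [m'] and [n'] of
   the conjugacy relation coprime. *)
set d := gcdz m n in d0 Dm Dn; pose N := (N0 * d)%R.
have NN : N <> 0%R by apply: mulz_neq0 => //; exact/eqP.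
have kl_g : expgz (expgz (a_ u) N) m' ^ g = expgz (expgz (a_ u) N) n'.
  rewrite -!expgzM /N -!mulrA ![(d * _)%R]mulrC -Dm -Dn ![(N0 * _)%R]mulrC !expgzM.
  by rewrite -expgz_conj -expgz_conj mn.
have [i small] := expr_unbounded (`|N%:~R|)%R slope_g.
exists (g ^+ i), N; split=> [k|p /N0Y[r N0r]]; last first.
  apply: (elliptic_commute i m'n' kl_g (r := (r * d)%R)).
  by rewrite /N !expgzM N0r.
move=> /(congr1 phi).
rewrite (phi_conj phi_vertex slope_neq0 phi_slope) (phi_expgz phi_vertex) => /translation_inj.
have slopeX : slope (g ^+ i) = (slope g ^+ i)%R.
  elim: (i) => [|j IHj]; first exact: slope1 phi_slope.
  by rewrite expgS exprS (slopeM phi_slope) IHj.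
have s0 : (slope (g ^+ i) != 0)%R by exact/eqP.
have cu0 : ((c u)%:~R != 0 :> rat)%R by rewrite intr_eq0; exact/eqP.
clearbody N; rewrite !intrM mulrCA => /(mulfI cu0) Nk.
have {}Nk : (N%:~R = slope (g ^+ i) * k%:~R)%R by rewrite -Nk mulVKf.
move: small; rewrite Nk normrM slopeX normrX; apply/negP.
rewrite -leNgt ler_peMr ?exprn_ge0 // -intr_norm ler1z -gtz0_ge1 normr_gt0.
by apply/eqP => k0; apply: NN; apply/eqP; rewrite -(intr_eq0 rat) Nk k0 mulr0.
Qed.

(** Apply [elliptic_path] to the normal form of [h^-1], where [h] comes from [commuting_elliptic]:
    its first alternative would put the conjugate in the vertex group. *)
Lemma rigid_crossing u g (Y : seq (V * G)) : (1 < `|slope g|)%R ->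
  exists x (h : G) j, [/\ source x = u, reduced_path x (reverse x) h &
    forall p, p \in Y -> commute (h ^ expgz (a_ u) j) (a_ p.1 ^ p.2)].
Proof.
move=> /(@commuting_elliptic u _ Y)[h [N [ne_u comm]]].
have := normal_form Gamma_connected T_max u h^-1.
case=> [[_ [k Dh]]|[x [y [p [j [k [red xu yu Dh]]]]]]].
  case: (ne_u N); rewrite -[h]invgK Dh.
  exact/conjg_fixP/commgP/commuteV/commute_expgz2.
have Nh : expgz (a_ u) N ^ h = (expgz (a_ (target y)) N ^ p^-1) ^ expgz (a_ u) (- j)%R.
  rewrite -[h]invgK Dh !invgM conjgM conjgM yu expgzN; congr (conjg (conjg _ _) _).
  exact/conjg_fixP/commgP/commuteV/commute_expgz2.
have [[l Nl]|red2] := elliptic_path N red.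
  case: (ne_u l); rewrite Nh Nl xu.
  exact/conjg_fixP/commgP/commute_expgz2.
exists x, (expgz (a_ (target y)) N ^ p^-1), (- j)%R; split=> // q /comm.
by rewrite Nh.
Qed.

(** For edges starting at [u], these generate stabilizers, in the Bass-Serre tree, of the base lift
    of [u] and of vertices at distance one and two. *)
Definition crossing_tests u : seq (V * G) :=
  (u, 1) :: [seq (target z, (cross z)^-1) | z <- enum {: E * bool}] ++
  [seq (target z', (cross z * cross z')^-1) | z <- enum {: E * bool}, z' <- enum {: E * bool}].

(* In the Bass-Serre tree, x is the direction from the base lift of u to the fixed tree
   of h. A vertex stabilizer commuting with h preserves this fixed tree, hence fixes the
   first edge on the way to it, whose label at that vertex is therefore a unit. *)
Lemma rigid_labels u g : (1 < `|slope g|)%R -> exists x, [/\ source x = u,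
  divides (lab x) 1,
  (forall z, source z = u -> z <> x -> divides (lab (reverse z)) 1) &
  (forall z z', source z = u -> z <> x -> source z' = target z -> z' <> reverse z ->
     divides (lab (reverse z')) 1)].
Proof.
move=> /(@rigid_crossing u _ (crossing_tests u))[x [h [j [xu red comm]]]].
have commute_test w t : (w, t^-1) \in crossing_tests u ->
    commute (h ^ (expgz (a_ u) j * t)) (a_ w).
  by move=> /comm/(commute_conj t); rewrite -!conjgM mulVg conjg1.
(* Moving the base point across [z] lengthens the path at both ends; it stays reduced as [z] is not
   [x]. *)
have red_z z : source z = u -> z <> x ->
    reduced_path (reverse z) z (h ^ (expgz (a_ u) j * cross z)).
  move=> zu zx; have := @reduced_path_conj _ lam ET (reverse z) x (reverse x) h (- j)%R red.
  rewrite !target_reverse xu zu expgzN crossing_reverse invgM !invgK reverseK; apply=> //.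
    by move=> xz; case: zx.
  by move=> /(can_inj (@reverseK _)) xz; case: zx.
exists x; split=> // [|z zu zx|z z' zu zx z'z z'nz]; apply: contrapT => nd.
- apply: (reduced_path_not_commute red) => //; first by rewrite target_reverse.
  rewrite xu; have := @commute_test u 1; rewrite mulg1 invg1 inE eqxx => /(_ isT).
  move/(commute_conj (expgz (a_ u) (- j)%R)); rewrite expgzN conjgK.
  by rewrite (_ : a_ u ^ _ = a_ u) //; apply/conjg_fixP/commgP/commuteV/commute_expgz.
- apply: (reduced_path_not_commute (red_z z zu zx)) => //.
  apply: commute_test; rewrite inE mem_cat; apply/orP; right; apply/orP; left.
  by apply/mapP; exists z; rewrite ?mem_enum.
(* The same, one edge further. *)
- have := @reduced_path_conj _ lam ET (reverse z') _ _ _ 0%R (red_z z zu zx).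
  rewrite mulg1 crossing_reverse invgK -conjgM reverseK target_reverse source_reverse.
  move=> /(_ (esym z'z) erefl) red2; apply: reduced_path_not_commute (red2 _ _) _ nd _ => //.
  + by move=> z_eq; case: z'nz.
  + by move=> z_eq; case: z'nz; rewrite z_eq reverseK.
  + rewrite -mulgA; apply: commute_test; rewrite inE mem_cat.
    apply/orP; right; apply/orP; right; apply/allpairsP; exists (z, z').
    by rewrite !mem_enum.
Qed.

End ResidualConsequences.

(** * Unimodularity, and the necessary conditions on labels and signs *)

Section Unimodularity.
Variables (Gamma : graph) (lam : labeling Gamma).
Variables (VT : {set vertex Gamma}) (ET : {set edge Gamma}).
Hypothesis Gamma_nonempty : (0 < #|vertex Gamma|)%N.
Hypothesis Gamma_connected : connected_graph Gamma.
Hypothesis T_max : maximal_subtree VT ET.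
Hypothesis lam_neq0 : forall e b, lam e b <> 0%R.
Hypothesis lam_reduced : reduced_labeling lam.

Notation V := (vertex Gamma).
Notation E := (edge Gamma).
Notation G := (gbs_group lam ET).
Notation a_ := (gbs_vertex lam ET).
Notation cross := (crossing lam ET).
Notation lab := (label lam).
Implicit Types (x y z : E * bool) (g h : G) (k l : int).

Variables (c : V -> int) (phi : {multiplicative G -> bijection rat}) (slope : G -> rat).
Hypothesis c_neq0 : forall v, c v <> 0%R.
Hypothesis phi_vertex : forall v, phi (a_ v) = translation (c v)%:~R.
Hypothesis slope_stable : forall e, slope (stable_letter lam ET e) = edge_slope lam c e.
Hypothesis slope_neq0 : forall g, slope g <> 0%R.
Hypothesis phi_slope : forall g (r s : rat), (phi g r - phi g s = slope g * (r - s))%R.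


Variable rho : nat_pred.
Hypothesis resid : residually (@rho_group rho) G.

Lemma divides1 k : divides k 1 -> `|k|%N = 1%N.
Proof. by case=> j /(congr1 absz); rewrite abszM => /esym/eqP; rewrite muln_eq1 => /andP[/eqP]. Qed.

Lemma loops_single_vertex : (forall e : E, is_loop e) -> forall u v : V, u = v.
Proof.
move=> loops u v; have /connectP[p] := Gamma_connected (finset.in_setT u) (finset.in_setT v).
elim: p u => [|w p IHp] u //= /andP[/existsP[e /andP[_ /existsP[b /andP[/eqP <- /eqP we]]]] wp].
by move=> vl; rewrite -(IHp w wp vl) -we; have := loops e; rewrite /is_loop; case: (b) => /= ->.
Qed.

Lemma slope_loops : (forall u v : V, u = v) -> (forall x, divides (lab x) 1) ->
  forall g, `|slope g|%R = 1%R.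
Proof.
move=> one lab1.
have cross1 x : `|slope (cross x)|%R = 1%R.
  rewrite (slope_crossing slope_stable slope_neq0 phi_slope) normf_div -!intr_norm.
  have normE y : `|lab y * c (source y)|%R = `|c (source x)|%R.
    by rewrite normrM -(abszE (lab y)) (divides1 (lab1 y)) mul1r (one (source y) (source x)).
  rewrite normE -source_reverse normE divff // intr_eq0 normr_eq0; exact/eqP.
elim/gbs_ind => [|v k g IHg|x g IHg].
- by rewrite (slope1 phi_slope) normr1.
- by rewrite (slopeM phi_slope) (slope_vertex phi_vertex phi_slope) mul1r.
- by rewrite (slopeM phi_slope) normrM cross1 IHg mulr1.
Qed.

(** By reducedness, the unit labels given by [rigid_labels] make every edge a loop, so there is one
    vertex. A single loop with a unit label remains, and the group is an ascending HNN extension. *)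
Lemma nonunimodular_solvable g : `|slope g|%R <> 1%R -> solvable_group G.
Proof.
move=> slope_g.
have [{slope_g}g slope_g] : exists g', (1 < `|slope g'|)%R.
  have [lt1|gt1|//] := ltgtP (`|slope g|)%R 1%R; last by exists g.
  exists g^-1; rewrite (slopeV slope_neq0 phi_slope) normfV invf_gt1 // normr_gt0.
  exact/eqP.
have labels u := rigid_labels Gamma_connected T_max lam_neq0 c_neq0 phi_vertex slope_neq0 phi_slope resid u slope_g.
have loops (e : E) : is_loop e.
  have [x [_ x1 tgt1 _]] := labels (source (e, true)).
  have [ex|/(tgt1 (e, true) erefl)/divides1] := pselect ((e, true) = x); last exact: lam_reduced.
  by move: x1; rewrite -ex => /divides1; exact: lam_reduced.
have one := loops_single_vertex loops.
have /card_gt0P[v0 _] := Gamma_nonempty.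
have [x [_ x1 tgt1 tgt2]] := labels v0.
(* Otherwise all labels would be units and all slopes of absolute value 1. *)
have nx1 : ~ divides (lab (reverse x)) 1.
  move=> rx1; have lab1 z : divides (lab z) 1.
    have [->//|zx] := pselect (z = reverse x).
    rewrite -[z]reverseK; apply: tgt1 => // zx'; apply: zx.
    by rewrite -zx' reverseK.
  by move: slope_g; rewrite (slope_loops one lab1) ltxx.
(* The path crossing another edge and then [x] would make the label of [reverse x] a unit. *)
have only_x e : e = x.1.
  apply: contrapT => ex; apply: nx1; apply: (tgt2 (e, true)) => //.
    by move=> xe; apply: ex; rewrite -xe.
  by move=> xe; apply: ex; rewrite xe.
have [n x1n] := x1.
have as_n : a_ v0 ^ cross x = expgz (a_ v0) (lab (reverse x) * n)%R.
  have := crossing_rel lam ET x n; rewrite -x1n (one (source x) v0) (one (target x) v0).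
  by rewrite /= expg1 conjgE => ->; rewrite mulKg.
apply: (ascending_hnn_solvable as_n) => P P1 Pa Ps PsV.
apply: gbs_ind => // [v k h Ph|z h Ph]; first by rewrite (one v v0); exact: Pa.
have [->|->] : z = x \/ z = reverse x.
- case: z => e b; rewrite (only_x e) /reverse; case: (x) => f [] /=; case: b; auto.
- exact: Ps.
- by rewrite crossing_reverse; exact: PsV.
Qed.

Hypothesis G_nonsolvable : ~ solvable_group G.

Lemma unimodular g : `|slope g|%R = 1%R.
Proof. by apply: contrapT => /nonunimodular_solvable. Qed.

(** By reducedness the edge is a loop, and unimodularity equates the absolute values of its two
    labels. *)
Lemma label_divides1 x : divides (lab (reverse x)) 1 -> `|lab x|%N = 1%N.
Proof.
move=> rx1; have rx1' := divides1 rx1.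
have loop : source x = target x.
  have /= := lam_reduced rx1'; rewrite /is_loop /source /target.
  by case: x.2 => /= ->.
have := unimodular (cross x).
rewrite (slope_crossing slope_stable slope_neq0 phi_slope) normf_div -!intr_norm.
rewrite !normrM -(abszE (lab (reverse x))) rx1' mul1r loop.
rewrite intrM mulfK => [/eqP|]; last by rewrite intr_eq0 normr_eq0; exact/eqP.
by rewrite -[1%R]/(1%:~R)%R eqr_int -abszE => /eqP[].
Qed.

Lemma labels_rho x : rho.-nat `|lab x|%N.
Proof.
have lab0 y : (0 < `|lab y|)%N by rewrite absz_gt0; apply/eqP/lam_neq0.
apply/pnatP => // q q_pr; case/dvdnP=> d Dq; apply: contrapT => /negP nq.
have q_gt1 := prime_gt1 q_pr.
have nd_rx : ~ divides (lab (reverse x)) 1.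
  move/label_divides1 => x1; move: q_gt1; rewrite ltnNge.
  by have /dvdn_leq -> // : (q %| 1)%N; rewrite -x1 Dq dvdn_mull.
have nd_d : ~ divides (lab x) d%:Z.
  case=> j /(congr1 absz); rewrite abszM Dq /= => dj.
  have d_gt0 : (0 < d)%N by move: (lab0 x); rewrite Dq; case: (d).
  have : (d * q %| d)%N by rewrite {2}dj dvdn_mulr.
  move/(dvdn_leq d_gt0); rewrite -{2}[d]muln1 leq_pmul2l //.
  by rewrite leqNgt q_gt1.
(* In every rho-quotient this becomes a power of the generator at the target of [x], although its
   path is reduced. *)
pose h := cross (reverse x) * expgz (a_ (source x)) d * cross x.
have red : reduced_path (reverse x) x h.
  have := reduced_path_cat (k := d) (reduced_path1 lam ET (reverse x)) (reduced_path1 lam ET x).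
  by rewrite target_reverse reverseK => /(_ erefl (fun=> nd_d)).
apply: (reduced_path_not_commute T_max c_neq0 phi_vertex red) nd_rx _ => //.
rewrite source_reverse; apply: (residual_commute resid) => H f [periodic rhoH].
have [n ord_n] := periodic (f (a_ (source x))).
have n_rho := rhoH _ _ ord_n.
have n_q : coprimez n q%:Z.
  rewrite coprimezE /= coprime_sym prime_coprime //; apply: contra nq => qn.
  by apply: (pnatP _ _ n_rho) => //; case: ord_n.
have [j fj] := expgz_coprime ord_n n_q.
have lab_x : exists e : int, ((d * q)%N%:Z = lab x * e)%R.
  by exists (sgz (lab x)); rewrite -Dq abszEsg mulrC.
have [e De] := lab_x.
have -> : f h = f (expgz (a_ (target x)) (lab (reverse x) * (e * j))%R).
  have -> : f h = f (expgz (a_ (source x)) d) ^ f (cross x).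
    by rewrite /h crossing_reverse -mulgA !gmulfM multV conjgE.
  have -> : f (expgz (a_ (source x)) d)
      = f (expgz (a_ (source x)) (lab x * (e * j))%R).
    by rewrite !mult_expgz {1}fj -expgzM mulrA -De PoszM mulrC mulrA.
  by rewrite -multJ conjgE crossing_rel mulKg.
apply: gmulf_commute; exact/commute_sym/commute_expgz.
Qed.

Lemma odd_inversion g : slope g = (-1)%R -> 2 \in rho.
Proof.
move=> slope_g; apply: contrapT => /negP n2.
have /card_gt0P[v0 _] := Gamma_nonempty.
have [m [n [m0 n0 mn]]] := commensurable_elliptic Gamma_connected T_max lam_neq0 v0 v0 g.
have nm : n = (- m)%R.
  apply/eqP; rewrite -(eqr_int rat) -subr_eq0; apply/eqP.
  have cv : ((c v0)%:~R != 0 :> rat)%R by rewrite intr_eq0; exact/eqP.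
  apply: (mulfI cv); rewrite mulr0 mulrBr -!intrM.
  have := congr1 phi mn; rewrite expgz_conj (phi_conj phi_vertex slope_neq0 phi_slope).
  rewrite (phi_expgz phi_vertex) => /translation_inj <-.
  by rewrite slope_g invrN invr1 mulN1r mulrN rmorphN /= subrr.
have am : expgz (a_ v0) m <> 1.
  move=> am1; have := expgz_vertex_neq1 c_neq0 phi_vertex (v := v0) (g := 1) m0.
  by rewrite am1 conjg1.
have [H [f [[periodic rhoH] _ fam]]] := resid am.
set b := f (expgz (a_ v0) m) in fam.
have bg : b ^ f g = b^-1.
  by rewrite -multJ -expgz_conj mn nm expgzN multV.
(* An odd power of [f g] still inverts [b], but the power [r] is trivial; hence [b] has order 2. *)
have [r ord_r] := periodic (f g); have r_odd : odd r.
  have := rhoH _ _ ord_r; case: (boolP (odd r)) => // r_even.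
  move/pnatP; case: ord_r => r_gt0 _ _ /(_ r_gt0 2 isT) r2.
  by case/negP: n2; apply: r2; rewrite dvdn2 r_even.
have bgn i : b ^ (f g ^+ i) = if odd i then b^-1 else b.
  elim: i => [|i IHi]; first by rewrite conjg1.
  by rewrite expgSr conjgM IHi /=; case: (odd i); rewrite /= ?conjVg bg ?invgK.
have bV : b = b^-1.
  have := bgn r; rewrite r_odd; case: ord_r => _ -> _.
  by rewrite conjg1.
have /rhoH : has_order b 2.
  split=> //; first by rewrite expg2 {2}bV mulgV.
  by case=> [|[|i]] // _; rewrite expg1 => /fam.
by move/pnatP => /(_ isT 2 isT (dvdnn 2)); rewrite (negPf n2).
Qed.

End Unimodularity.

From mathcomp Require Import all_fingroup all_solvable.

(** * Finite quotients *)

Section FiniteGroups.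
Variable rho : nat_pred.

Lemma pgroup_of_exponents (gT : finGroupType) (A : {group gT}) :
  (forall x, x \in A -> exists2 n, rho.-nat n & x ^+ n = 1) -> rho.-group A.
Proof.
move=> expA; apply/pgroupP => q q_pr /(Cauchy q_pr)[x Ax ord_x].
have [n n_rho /eqP] := expA x Ax; rewrite -order_dvdn ord_x => q_n.
by apply: (pnatP _ _ n_rho) => //; case: (n) n_rho.
Qed.

Lemma has_order_order (gT : finGroupType) (x : gT) n : has_order x n -> n = #[x].
Proof.
move=> [n_gt0 xn min_n]; apply/eqP; rewrite eqn_leq min_n ?order_gt0 ?expg_order //.
by rewrite dvdn_leq // order_dvdn xn.
Qed.

Lemma finite_rho_group (gT : finGroupType) : rho.-group [set: gT]%SET -> rho_group rho gT.
Proof.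
move=> rhoT; split=> [x|x n /has_order_order ->].
  exists #[x]; split=> [||m m_gt0 xm]; rewrite ?order_gt0 ?expg_order //.
  by rewrite dvdn_leq // order_dvdn xm.
by apply: (pnat_dvd _ rhoT); apply: order_dvdG; rewrite finset.in_setT.
Qed.

Lemma derived_series_derg (gT : finGroupType) n (x : gT) :
  derived_series n x -> x \in ([set: gT]%SET^`(n))%g.
Proof.
elim: n x => [|n IHn] x; first by rewrite derg0 finset.in_setT.
apply: (@smallest_sub _ _ _ [set y | y \in ([set: gT]%SET^`(n.+1))%g]%classic) => /=.
  by split=> [|y z yT zT]; rewrite /= ?group1 ?groupM ?groupV.
by move=> _ [y [z [/IHn yT /IHn zT ->]]] /=; rewrite dergSn mem_commg.
Qed.

Lemma derived_series1 (G : groupType) n : @derived_series G n 1.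
Proof. by case: n => // n A [[A1 _] _]. Qed.

Lemma finite_solvable_group (gT : finGroupType) :
  solvable [set: gT]%SET -> solvable_group gT.
Proof.
move=> /derivedP[n solT]; exists n; apply/seteqP; split=> x.
  by move=> /derived_series_derg; rewrite solT inE => /eqP.
by move=> ->; exact: derived_series1.
Qed.

(** A class contained in all four classes of the theorem. *)
Definition finite_solvable_rho (H : groupType) : Prop :=
  [/\ finite_group H, solvable_group H, rho_group rho H & finite_exponent H].

Lemma finite_quotient (G : groupType) (gT : finGroupType) (A : {group gT})
    (f : {multiplicative G -> gT}) g :
  (forall h, f h \in A) -> rho.-group A -> solvable A -> f g <> 1 ->
  exists (H : groupType) (sigma : {multiplicative G -> H}),
    [/\ finite_solvable_rho H, (forall h : H, exists x : G, sigma x = h) & sigma g <> 1].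
Proof.
move=> fA rhoA solA fg.
pose Im := [set x : gT | `[< exists h, f h = x >]]%SET.
have ImP x : reflect (exists h, f h = x) (x \in Im) by rewrite inE; exact: asboolP.
have Im_group : group_set Im.
  apply/group_setP; split=> [|x y /ImP[h <-] /ImP[h' <-]]; apply/ImP.
    by exists 1; rewrite mult1.
  by exists (h * h'); rewrite gmulfM.
pose I := Group Im_group.
have fI h : f h \in I by apply/ImP; exists h.
have IA : I \subset A by apply/fintype.subsetP => x /ImP[h <-].
have subgI : [set: subg_of I]%SET = (subg I @* I)%g by rewrite im_subg.
pose s h : subg_of I := subg I (f h).
have sM : {morph s : h h' / h * h'} by move=> h h'; rewrite /s gmulfM morphM.
exists (subg_of I), (HB.pack_for {multiplicative G -> subg_of I} s (isMultiplicative.Build _ _ s sM)).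
have rhoI : rho.-group [set: subg_of I]%SET.
  by rewrite subgI morphim_pgroup // (pgroupS IA).
split=> [|h|]; first split.
- exact: finite_finset.
- by apply: finite_solvable_group; rewrite subgI morphim_sol // (solvableS IA).
- exact: finite_rho_group.
- exists #|[set: subg_of I]%SET|; first exact: cardG_gt0.
  by move=> x; apply/eqP; rewrite -order_dvdn order_dvdG // finset.in_setT.
- have /ImP[x fx] := subgP h; exists x; rewrite /= /s fx.
  by rewrite sgvalK.
- move=> /= /(congr1 sgval); rewrite /s subgK //.
Qed.

End FiniteGroups.

(** * Signed translations of Z/N *)

Section SignedTranslations.
Variables (N : nat) (reflections : bool).
Hypothesis N_gt1 : 1 < N.

Notation Zn := 'Z_N.

Definition signed_translation (b : bool) (t : Zn) (x : Zn) : Zn := ((-1) ^+ b * x + t)%R.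

Lemma signed_translation_inj b t : injective (signed_translation b t).
Proof. by move=> x y /addIr; apply: mulrI; rewrite unitrX // unitrN unitr1. Qed.

Definition sperm b t : {perm Zn} := perm (@signed_translation_inj b t).

Lemma spermM b c t u : sperm b t * sperm c u = sperm (b (+) c) ((-1) ^+ c * t + u)%R.
Proof.
by apply/permP => x; rewrite permM !permE /signed_translation signr_addb; ring.
Qed.

Lemma sperm1 : sperm false 0%R = 1.
Proof. by apply/permP => x; rewrite permE perm1 /signed_translation mul1r addr0. Qed.

Lemma spermV_false t : (sperm false t)^-1 = sperm false (- t)%R.
Proof. by apply/(mulgI (sperm false t)); rewrite mulgV spermM mul1r subrr sperm1. Qed.

Lemma spermX t n : sperm false t ^+ n = sperm false (t *+ n)%R.
Proof.
by elim: n => [|n IHn]; rewrite ?sperm1 // expgS IHn spermM mul1r mulrS.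
Qed.

Lemma expgz_sperm t k : expgz (sperm false t) k = sperm false (t *~ k)%R.
Proof. by case: k => n; rewrite /= spermX // spermV_false. Qed.

(** The flag [reflections] allows the sign -1; it will be the truth value of 2 being in rho. *)
Definition signed_set : {set {perm Zn}} :=
  [set f | [exists b : bool, (b ==> reflections) && [exists t, f == sperm b t]]]%SET.

Lemma signedP f : reflect (exists b t, (b ==> reflections) /\ f = sperm b t) (f \in signed_set).
Proof.
rewrite inE; apply: (iffP existsP) => [[b /andP[br /existsP[t /eqP ->]]]|[b [t [br ->]]]].
  by exists b, t.
by exists b; rewrite br; apply/existsP; exists t.
Qed.

Lemma signed_group_set : group_set signed_set.
Proof.
apply/group_setP; split=> [|f g /signedP[b [t [br ->]]] /signedP[c [u [cr ->]]]].
  by apply/signedP; exists false, 0%R; rewrite sperm1.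
apply/signedP; exists (b (+) c), ((-1) ^+ c * t + u)%R; rewrite spermM; split=> //.
by case: b c br cr => -[].
Qed.

Definition signed_group : {group {perm Zn}} := Group signed_group_set.

Lemma signed_group_rho (rho : nat_pred) : rho.-nat N -> (reflections -> 2 \in rho) ->
  rho.-group signed_group.
Proof.
move=> rhoN rho2; apply: pgroup_of_exponents => f /signedP[b [t [br ->]]].
have exp_trans u : sperm false u ^+ N = 1.
  by rewrite spermX -mulr_natr pchar_Zp // mulr0 sperm1.
case: b br => /= br; last by exists N.
exists (2 * N)%N; last by rewrite expgnA expg2 spermM exp_trans.
by rewrite pnatM rhoN andbT pnatE // rho2.
Qed.

(** Commutators are translations, and translations commute. *)
Lemma signed_group_solvable : solvable signed_group.
Proof.
pose trans := [set sperm false t | t : Zn]%SET.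
have commT f g : f \in signed_group -> g \in signed_group -> [~ f, g] \in trans.
  move=> /signedP[b [t [_ ->]]] /signedP[c [u [_ ->]]].
  have [v Dv] : exists v, sperm b t * sperm c u = (sperm c u * sperm b t) * sperm false v.
    exists (((-1) ^+ c * t + u) - ((-1) ^+ b * u + t))%R.
    rewrite !spermM addbF [c (+) b]addbC mul1r; congr sperm.
    by rewrite [RHS]addrC subrK.
  by apply/imsetP; exists v => //; rewrite commgEl conjgE mulgA -invgM Dv mulKg.
apply/derivedP; exists 2%N; apply/trivgP; rewrite /= dergSn derg1.
have der_trans f : f \in [~: signed_group, signed_group] -> f \in trans.
  have trans_group : group_set trans.
    apply/group_setP; split=> [|_ _ /imsetP[t _ ->] /imsetP[u _ ->]].
      by apply/imsetP; exists 0%R; rewrite ?sperm1.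
    by rewrite spermM; apply: imset_f.
  suff /fintype.subsetP sub : [~: signed_group, signed_group] \subset Group trans_group by exact: sub.
  rewrite gen_subG; apply/fintype.subsetP => _ /imset2P[g h Ag Ah ->]; exact: commT.
rewrite gen_subG; apply/fintype.subsetP => _ /imset2P[f g Af Ag ->].
have /imsetP[t _ ->] := der_trans f Af; have /imsetP[u _ ->] := der_trans g Ag.
rewrite inE; apply/commgP.
by rewrite /commute !spermM !mul1r addrC.
Qed.

Lemma sperm_inj b c t u : sperm b t = sperm c u -> t = u.
Proof.
by move/permP/(_ 0%R); rewrite !permE /signed_translation !mulr0 !add0r.
Qed.

Lemma Zn_intr_eq0 k : (k%:~R == 0 :> Zn)%R = (N %| `|k|)%N.
Proof.
have aux n : (n%:R == 0 :> Zn)%R = (N %| n)%N.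
  by rewrite -val_eqE /= val_Zp_nat.
by case: k => n; rewrite ?NegzE ?mulrNz ?oppr_eq0; exact: aux.
Qed.

End SignedTranslations.

Section SignedRepresentation.
Variables (Gamma : graph) (lam : labeling Gamma).
Variable ET : {set edge Gamma}.
Hypothesis lam_neq0 : forall e b, lam e b <> 0%R.

Notation V := (vertex Gamma).
Notation G := (gbs_group lam ET).
Notation a_ := (gbs_vertex lam ET).

Variable c : V -> int.
Hypothesis c_neq0 : forall v, c v <> 0%R.
Hypothesis c_tree : forall e, e \in ET ->
  (lam e true * c (edge_end e true) = lam e false * c (edge_end e false))%R.

(** The translation representation modulo [N]: dilations by 1 or -1 make sense there. *)
Lemma signed_representation (N : nat) (reflections : bool) : (1 < N)%N ->
  (forall e, edge_slope lam c e = 1%R \/ reflections /\ edge_slope lam c e = (-1)%R) ->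
  exists theta : {multiplicative G -> {perm 'Z_N}},
    (forall v k, theta (expgz (a_ v) k) = @sperm N false (c v * k)%:~R%R) /\
    (forall g, theta g \in signed_group N reflections).
Proof.
move=> N_gt1 slope1.
have slopeE e (b : bool) : edge_slope lam c e = ((-1) ^+ b)%R ->
    (lam e true * c (edge_end e true) = (-1) ^+ b * (lam e false * c (edge_end e false)))%R.
  rewrite /edge_slope => /(canRL (mulfVK (lam_c_neq0 lam_neq0 c_neq0 e false))) sl.
  apply/eqP; rewrite -(eqr_int rat) sl [in X in _ == X]intrM.
  by case: b {sl}; rewrite ?expr1 ?expr0 // mulrNz.
pose sg e := edge_slope lam c e != 1%R.
have sgE e : edge_slope lam c e = ((-1) ^+ sg e)%R.
  by rewrite /sg; case: (slope1 e) => [->|[_ ->]]; rewrite ?eqxx.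
have [||theta [thV thE]] := @gbs_lift _ lam ET _
  (fun v => @sperm N false (c v)%:~R%R) (fun e => @sperm N (sg e) 0%R).
- move=> e eT; rewrite /sg /edge_slope c_tree // divff ?eqxx ?sperm1 //.
  exact: lam_c_neq0.
- move=> e; rewrite !expgz_sperm !spermM addbF addFb addr0 mulr0 add0r.
  congr sperm; rewrite -!mulrzA ![(c _ * _)%R]mulrC (slopeE _ _ (sgE e)) intrM mulrA.
  by rewrite rmorphXn /= rmorphN -exprD addnn -mul2n exprM sqrrN expr1n expr1n mul1r.
exists theta; split=> [v k|g].
  by rewrite mult_expgz thV expgz_sperm -mulrzA.
elim/gbs_ind: g => [|v k g IHg|x g IHg]; first by rewrite mult1 group1.
  rewrite gmulfM groupM // mult_expgz thV expgz_sperm.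
  by apply/signedP; exists false; eexists.
rewrite gmulfM groupM // /crossing.
have thS e : theta (stable_letter lam ET e) \in signed_group N reflections.
  apply/signedP; rewrite thE; exists (sg e), 0%R; split=> //.
  by apply/implyP; rewrite /sg; case: (slope1 e) => [->|[]]; rewrite ?eqxx.
by case: x.2; rewrite ?multV ?groupV.
Qed.

End SignedRepresentation.

(** * Layered permutations: an extension by a finite p-group *)

Section LayerGroup.
Variables (Q : finGroupType) (p L : nat).
Hypothesis p_prime : prime p.

Notation F := 'F_p.
Notation I := 'I_L.+1.
Notation T := {ffun I * Q -> F}.
Implicit Types (v w : T) (f : T -> T) (k : {perm T} * Q).

Definition vanishing (m : nat) v : Prop := forall (l : I) x, (l < m)%N -> v (l, x) = 0%R.

Definition additive f : Prop := forall v w, f (v + w)%R = (f v + f w)%R.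

(** [f] preserves the filtration by lowest layer and acts on the graded pieces as the shift by
    [q]. *)
Definition layered f (q : Q) : Prop := additive f /\
  forall m v, vanishing m v -> forall (l : I) x, (l <= m)%N -> f v (l, x) = v (l, x * q).

Definition raising r f : Prop := forall m v, vanishing m v -> vanishing (m + r) (f v - v)%R.

Lemma layered_comp f g q r : layered f q -> layered g r -> layered (f \o g) (q * r).
Proof.
move=> [addf lf] [addg lg]; split=> [v w|m v vm l x lm] /=; first by rewrite addg addf.
have gvm : vanishing m (g v).
  by move=> l' x' lt; rewrite (lg _ _ vm _ _ (ltnW lt)) vm.
by rewrite (lf _ _ gvm) // (lg _ _ vm) // mulgA.
Qed.

Lemma layered_raising f : layered f 1 -> raising 1 f.
Proof.
move=> [_ lf] m v vm l x; rewrite addn1 ltnS => lm.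
by rewrite ffunE /= [X in (_ + X)%R]ffunE (lf _ _ vm) // mulg1 subrr.
Qed.

Lemma vanishingD m v w : vanishing m v -> vanishing m w -> vanishing m (v + w)%R.
Proof. by move=> vm wm l x lm; rewrite ffunE vm // wm // addr0. Qed.

Lemma vanishingMn m v n : vanishing m v -> vanishing m (v *+ n)%R.
Proof.
move=> vm; elim: n => [|n IHn]; first by move=> l x _; rewrite mulr0n ffunE.
by rewrite mulrS; exact: vanishingD.
Qed.

Lemma vanishing_sub m m' v : (m <= m')%N -> vanishing m' v -> vanishing m v.
Proof. by move=> mm' vm l x lm; apply: vm; apply: leq_trans lm mm'. Qed.

Lemma binomial_step (a b c d : T) n :
  (a + c *+ n + d - b - (a - b) *+ n.+1 = (c - (a - b)) *+ n + d)%R.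
Proof. by apply/ffunP => i; rewrite !(ffunE, ffunMnE); ring. Qed.

(** Write [f] as 1 + n. In the p-th power the linear term p n vanishes in characteristic p, and the
    remaining terms raise by at least 2r, hence by [r.+1]. *)
Lemma raising_iter r f : (0 < r)%N -> additive f -> raising r f -> raising r.+1 (iter p f).
Proof.
move=> r_gt0 addf rf m v vm.
have addfB w : f w = (w + (f w - w))%R by rewrite addrC subrK.
have iter_f n : vanishing (m + r.+1) (iter n f v - v - (f v - v) *+ n)%R.
  elim: n => [|n IHn] /=; first by move=> l x _; rewrite subrr mulr0n subr0 ffunE.
  set N := (f v - v)%R in IHn *; set e := (iter n f v - v - N *+ n)%R in IHn.
  have Ne : iter n f v = (v + N *+ n + e)%R.
    by rewrite addrC /e -[(iter n f v - v - _)%R]addrA -opprD subrK.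
  have fMn w n' : f (w *+ n')%R = (f w *+ n')%R.
    elim: n' => [|n' IHn']; last by rewrite !mulrS addf IHn'.
    by apply: (addrI (f 0%R)); rewrite -addf !mulr0n !addr0.
  clearbody e; rewrite Ne !addf fMn binomial_step (addfB e).
  apply: vanishingD; last apply: vanishingD => //.
    apply/vanishingMn/(@vanishing_sub _ (m + r + r)); last exact/rf/rf.
    by rewrite -addnA leq_add2l; lia.
  by apply: (@vanishing_sub _ (m + r.+1 + r)); [lia|exact: rf].
have := iter_f p; suff -> : ((f v - v) *+ p = 0)%R by rewrite subr0.
by apply/ffunP => i; rewrite ffunMnE -mulr_natr pchar_Fp_0 // mulr0 ffunE.
Qed.

(** Each p-th power raises by one layer more; after [L] of them all [L.+1] layers are exhausted. *)
Lemma layered_order f : layered f 1 -> iter (p ^ L) f =1 id.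
Proof.
move=> lf; have rf n : raising n.+1 (iter (p ^ n) f).
  have add_iter j : additive (iter j f).
    by elim: j => [|j IHj] v w //=; rewrite IHj lf.1.
  elim: n => [|n IHn]; first exact: layered_raising.
  have := raising_iter (ltn0Sn n) (@add_iter (p ^ n)%N) IHn.
  suff -> : iter p (iter (p ^ n) f) = iter (p ^ n.+1) f by [].
  have iterM j i v : iter j (iter i f) v = iter (j * i) f v.
    by elim: j => [|j IHj] //=; rewrite IHj mulSn iterD.
  by apply/funext => v; rewrite iterM expnS.
move=> v; apply/ffunP => -[l x]; apply/eqP; rewrite -subr_eq0; apply/eqP.
have := rf L 0%N v; rewrite add0n => /(_ _ l x (ltn_ord l)); rewrite ffunE => <- //.
by rewrite [in RHS]ffunE.
Qed.

(* The inverse turns the right action of permutations into a left action. *)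
Definition layer_act k : T -> T := (k.1^-1)%g.

Lemma layer_actM k k' : layer_act (k * k') =1 layer_act k \o layer_act k'.
Proof. by move=> v; rewrite /layer_act /= invMg permM. Qed.

Lemma layer_act1 : layer_act 1 =1 id.
Proof. by move=> v; rewrite /layer_act /= invg1 perm1. Qed.

Lemma layer_actX k n : layer_act (k ^+ n) =1 iter n (layer_act k).
Proof.
by elim: n => [|n IHn] v; rewrite ?layer_act1 // expgS layer_actM /= IHn.
Qed.

(** Recording the shift as a second component makes the map to [Q] a projection, whose kernel is
    unipotent. *)
Definition layer_set : {set {perm T} * Q} :=
  [set k | `[< layered (layer_act k) k.2 >]]%SET.

Lemma layer_setP k : reflect (layered (layer_act k) k.2) (k \in layer_set).
Proof. by rewrite inE; exact: asboolP. Qed.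

Lemma layer_group_set : group_set layer_set.
Proof.
apply/group_setP; split=> [|k k' /layer_setP lk /layer_setP lk']; apply/layer_setP.
  by split=> [v w|m v vm l x lm]; rewrite !layer_act1 // mulg1.
have -> : layer_act (k * k') = layer_act k \o layer_act k' by exact/funext/layer_actM.
exact: layered_comp.
Qed.

Definition layer_group : {group {perm T} * Q} := Group layer_group_set.

Lemma layer_unipotent k : k \in layer_group -> k.2 = 1 -> k ^+ (p ^ L) = 1.
Proof.
case: k => s q /layer_setP /= lk q1; rewrite q1 in lk *.
have pow n : (s, 1 : Q) ^+ n = (s ^+ n, 1).
  by elim: n => [|n IHn] //; rewrite expgS IHn; exact: (congr2 pair (esym (expgS s n)) (mulg1 1)).
rewrite pow; congr pair; apply/eqP; rewrite -eq_invg1; apply/eqP/permP => v.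
have := layered_order lk v; rewrite -layer_actX pow /layer_act /= => ->.
by rewrite perm1.
Qed.

Lemma layer_group_rho (rho : nat_pred) : p \in rho -> rho.-group [set: Q]%SET ->
  rho.-group layer_group.
Proof.
move=> p_rho rhoQ; apply: pgroup_of_exponents => k Kk.
exists (#|[set: Q]%SET| * p ^ L)%N.
  by rewrite pnatM; apply/andP; split; [exact: rhoQ|rewrite pnatX pnatE ?p_rho].
rewrite expgM; apply: layer_unipotent; first exact: groupX.
have -> n : (k ^+ n).2 = k.2 ^+ n by elim: n => [|n IHn] //; rewrite expgS /= IHn -expgS.
by apply/eqP; rewrite -order_dvdn order_dvdG // finset.in_setT.
Qed.

Lemma layer_group_solvable : solvable [set: Q]%SET -> solvable layer_group.
Proof.
move=> solQ.
have sndM : {in layer_group &, {morph snd : k k' / k * k'}} by [].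
pose phi := Morphism sndM.
rewrite (series_sol (ker_normal phi)) (isog_sol (first_isog phi)).
rewrite (solvableS (finset.subsetT _) solQ) andbT.
apply: (pgroup_sol (p := p)); apply: pgroup_of_exponents => k.
move=> /morphpreP[Kk /set1gP k1]; exists (p ^ L)%N; last exact: layer_unipotent.
by rewrite pnatX pnat_id.
Qed.

End LayerGroup.

(** * Shifts and transvections inside the layer group *)

Section LayerElements.
Variables (Q : finGroupType) (p L : nat) (Y : eqType) (C : Y -> set Q).
Variable m : alternating Q Y.
Hypothesis C1 : forall y, C y 1.
Hypothesis CF : forall y c d, C y c -> C y d -> C y (c * d^-1).
Hypothesis m_reduced : alt_reduced C m.

Notation F := 'F_p.
Notation I := 'I_L.+1.
Notation T := {ffun I * Q -> F}.

Lemma bij_perm_inj (f : bijection (I * Q -> F)) :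
  injective (fun v : T => [ffun i => bij_inv f v i]).
Proof.
move=> v w /ffunP vw; apply/ffunP => i.
have {}vw : bij_inv f v = bij_inv f w.
  by apply/funext => j; have := vw j; rewrite !ffunE.
by rewrite -[fun_of_fin v](bij_invK f) vw bij_invK.
Qed.

(** Permutations compose from left to right and bijections from right to left; taking the inverse
    makes this a morphism. *)
Definition bij_perm (f : bijection (I * Q -> F)) : {perm T} := perm (@bij_perm_inj f).

Lemma bij_permV f (v : T) : (bij_perm f)^-1 v = [ffun i => f v i].
Proof.
apply: (@perm_inj _ (bij_perm f)); rewrite permKV permE; apply/ffunP => i.
rewrite ffunE (_ : fun_of_fin _ = f v) ?bij_funK //.
by apply/funext => j; rewrite ffunE.
Qed.

Lemma bij_permM : {morph bij_perm : f g / f * g}.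
Proof.
move=> f g; apply/permP => v; rewrite permM !permE; apply/ffunP => i; rewrite !ffunE /=.
by congr (bij_inv g _ _); apply/funext => j; rewrite ffunE.
Qed.

Definition bump_bijection y : bijection (I * Q -> F) := Bijection
  (@transvectionK _ _ C CF F L m m_reduced 1%R y)
  (@transvectionNK _ _ C CF F L m m_reduced 1%R y).

Definition shift_pair (q : Q) : {perm T} * Q := (bij_perm (shift_bijection F I q), q).
Definition bump_pair y : {perm T} * Q := (bij_perm (bump_bijection y), 1).

Lemma shift_pair_layer q : shift_pair q \in layer_group Q p L.
Proof.
apply/layer_setP; split=> [v w|n v vn l x ln].
  rewrite /layer_act /= !bij_permV; apply/ffunP => i; rewrite !ffunE /=.
  by rewrite /layer_shift !ffunE.
by rewrite /layer_act /= bij_permV ffunE.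
Qed.

Lemma bump_pair_layer y : bump_pair y \in layer_group Q p L.
Proof.
apply/layer_setP; split=> [v w|n v vn l x ln]; rewrite /layer_act /= !bij_permV.
  apply/ffunP => i; rewrite !ffunE /= /transvection !ffunE; case: alt_sel; ring.
rewrite !ffunE /= /transvection mulg1; case Es: alt_sel; rewrite ?addr0 //=.
have l_gt0 : (0 < l)%N by case: l ln Es => -[|l] //= lt _; rewrite alt_sel0.
have l_pred : (l.-1 < L.+1)%N := leq_ltn_trans (leq_pred l) (ltn_ord l).
by rewrite (vn (inord l.-1)) ?mulr0 ?mulr1n ?addr0 // inordK // prednK.
Qed.

Notation K := (subg_of (layer_group Q p L)).

Definition shift_elt q : K := subg (layer_group Q p L) (shift_pair q).
Definition bump_elt y : K := subg (layer_group Q p L) (bump_pair y).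

Lemma shift_eltM : {morph shift_elt : q r / q * r}.
Proof.
move=> q r; rewrite /shift_elt -morphM ?shift_pair_layer //; congr subg.
by rewrite /shift_pair gmulfM bij_permM.
Qed.

HB.instance Definition _ := isMultiplicative.Build Q K shift_elt shift_eltM.

Lemma shift_bump_commute y c : C y c -> commute (shift_elt c) (bump_elt y).
Proof.
move=> Cc; rewrite /commute /shift_elt /bump_elt -!morphM ?shift_pair_layer ?bump_pair_layer //.
congr subg; congr pair; last by rewrite /= mulg1 mul1g.
rewrite /= -!bij_permM; congr bij_perm; apply: bijectionP => v /=.
exact: shift_transvection.
Qed.

Lemma layer_detects q : size m = L -> m <> [::] ->
  alt_val shift_elt bump_elt m * shift_elt q <> 1.
Proof.
move=> szm m0.
pose act (k : K) (v : I * Q -> F) : I * Q -> F := layer_act (sgval k) [ffun i => v i].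
apply: (alt_val_neq1 C1 CF m_reduced szm (act := act)) m0 => [f g v|v|r v|y v].
- rewrite /act -[sgval (f * g)]/(sgval f * sgval g) layer_actM /=; congr (fun_of_fin (layer_act _ _)).
  by apply/ffunP => i; rewrite ffunE.
- by rewrite /act -[sgval 1]/1 layer_act1; apply/funext => i; rewrite ffunE.
- rewrite /act /shift_elt subgK ?shift_pair_layer // /layer_act /= bij_permV.
  by apply/funext => i; rewrite !ffunE /= /layer_shift !ffunE.
- rewrite /act /bump_elt subgK ?bump_pair_layer // /layer_act /= bij_permV.
  by apply/funext => i; rewrite !ffunE /= /transvection !ffunE.
Qed.

End LayerElements.

(** * Detecting reduced closed paths in finite quotients *)

Section ResidualFiniteness.
Variables (Gamma : graph) (lam : labeling Gamma).
Variables (VT : {set vertex Gamma}) (ET : {set edge Gamma}).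
Hypothesis T_max : maximal_subtree VT ET.

Notation G := (gbs_group lam ET).
Notation a_ := (gbs_vertex lam ET).
Notation lab := (label lam).

Lemma finite_detection (rho : nat_pred) p (Q : finGroupType)
    (theta : {multiplicative G -> Q}) x y g k :
  prime p -> p \in rho -> rho.-group [set: Q]%SET -> solvable [set: Q]%SET ->
  (forall x k l,
    theta (expgz (a_ (source x)) k) = theta (expgz (a_ (source x)) (lab x * l)%R) ->
    divides (lab x) k) ->
  reduced_path x y g -> source x = target y ->
  exists (H : groupType) (sigma : {multiplicative G -> H}),
    [/\ finite_solvable_rho rho H, (forall h : H, exists x : G, sigma x = h)
      & sigma (g * expgz (a_ (source x)) k) <> 1].
Proof.
move=> p_prime p_rho rhoQ solQ faithful red xy.
have [m [q [m0 m_red detect]]] := reduced_path_detect T_max faithful k red xy.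
have C1 z := edge_image1 theta z; have CF z := @edge_imageF _ _ _ _ theta z.
pose L := size m; pose A := layer_group Q p L.
have [z r Cr|f f1] := detect _ (shift_elt p L) (bump_elt p L CF m_red).
  exact: shift_bump_commute.
have fg : f (g * expgz (a_ (source x)) k) <> 1.
  by move/f1 => val1; exact: (layer_detects C1 (erefl L) m0 val1).
apply: (finite_quotient (A := [set: subg_of A]%G)) fg => [h||].
- by rewrite finset.in_setT.
- by rewrite /= -im_subg morphim_pgroup // layer_group_rho.
- by rewrite /= -im_subg morphim_sol // layer_group_solvable.
Qed.

End ResidualFiniteness.

(** * The condition on Delta and the labels, and the equivalences *)

Section Conclusion.
Variables (Gamma : graph) (lam : labeling Gamma).
Variables (VT : {set vertex Gamma}) (ET : {set edge Gamma}).
Hypothesis Gamma_nonempty : (0 < #|vertex Gamma|)%N.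
Hypothesis Gamma_connected : connected_graph Gamma.
Hypothesis T_max : maximal_subtree VT ET.
Hypothesis lam_neq0 : forall e b, lam e b <> 0%R.
Variable rho : nat_pred.
Hypothesis rho_primes : forall p, p \in rho -> prime p.

Notation E := (edge Gamma).
Notation G := (gbs_group lam ET).
Notation a_ := (gbs_vertex lam ET).
Notation lab := (label lam).

Definition delta_condition : Prop :=
  [/\ (range (Delta lam ET) `<=` [set 1%R; (-1)%R])%classic,
      forall e b, rho.-nat `|lam e b|%N
    & range (Delta lam ET) (-1)%R -> 2%N \in rho].

Lemma delta_condition_of_residual : reduced_labeling lam -> ~ solvable_group G ->
  residually (@rho_group rho) G -> delta_condition.
Proof.
move=> lam_reduced G_nonsolvable resid.
have [|c [c0 c_tree]] := integer_potential (P := fun k => k <> 0%R) _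
  (@mulz_neq0) lam_neq0 (spanning_acyclic T_max); first by [].
have [phi [slope [phiV slopeS slope0 phiS]]] :=
  translation_representation lam_neq0 c0 c_tree.
have /card_gt0P[v0 _] := Gamma_nonempty.
have DE g : Delta lam ET g = (slope g)^-1%R.
  exact: (DeltaE Gamma_connected T_max lam_neq0 c0 phiV slope0 phiS v0 g).
have norm1 := unimodular Gamma_nonempty Gamma_connected T_max lam_neq0 lam_reduced
  c0 phiV slopeS slope0 phiS resid G_nonsolvable.
split=> [_ [g _ <-]|e b|[g _ Dg]].
- rewrite DE; have /eqP := norm1 g; rewrite eqr_norml => /andP[/orP[]/eqP -> _].
    by left; rewrite invr1.
  by right; rewrite invrN invr1.
- exact: (labels_rho Gamma_nonempty Gamma_connected T_max lam_neq0 lam_reduced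
    c0 phiV slopeS slope0 phiS resid G_nonsolvable (e, b)).
- apply: (odd_inversion Gamma_nonempty Gamma_connected T_max lam_neq0 c0 phiV slope0 phiS resid (g := g)).
  by rewrite -[slope g]invrK -DE Dg invrN invr1.
Qed.

Lemma residual_of_delta_condition : (exists p, p \in rho) -> delta_condition ->
  residually (finite_solvable_rho rho) G.
Proof.
move=> [p p_rho] [Delta1 lam_rho Delta2] g g1; have p_pr := rho_primes p_rho.
(* Potentials that are rho-numbers allow the modulus [N] below to be a rho-number. *)
have [| |c [c_rho c_tree]] := integer_potential (P := fun k => rho.-nat `|k|%N) _
  _ lam_rho (spanning_acyclic T_max) => //.
  by move=> k l k_rho l_rho; rewrite abszM pnatM k_rho.
have c0 v : c v <> 0%R by move=> cv; have := c_rho v; rewrite cv.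
have [phi [slope [phiV slopeS slope0 phiS]]] :=
  translation_representation lam_neq0 c0 c_tree.
have /card_gt0P[v0 _] := Gamma_nonempty.
have DE h : Delta lam ET h = (slope h)^-1%R.
  exact: (DeltaE Gamma_connected T_max lam_neq0 c0 phiV slope0 phiS v0 h).
have slope_sign e : edge_slope lam c e = 1%R \/ 2%N \in rho /\ edge_slope lam c e = (-1)%R.
  rewrite -slopeS -[slope _]invrK -DE.
  have [->|Dm] := Delta1 _ (ex_intro2 _ _ (stable_letter lam ET e) I erefl).
    by left; rewrite invr1.
  right; rewrite Dm invrN invr1; split=> //; apply: Delta2.
  by exists (stable_letter lam ET e).
have [[_ [k Dg]]|[x [y [h [j [k [red xv0 yv0 Dg]]]]]]] :=
  normal_form Gamma_connected T_max v0 g.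
  (* Elliptic case: [N] exceeds the translation length, so a nontrivial translation survives modulo
     [N]. *)
  pose N := (p ^ (`|(c v0 * k)%R|%N.+1))%N.
  have N_gt : (`|(c v0 * k)%R|%N < N)%N by rewrite ltnW // ltn_expl ?prime_gt1.
  have N_gt1 : (1 < N)%N by rewrite -(exp1n (`|(c v0 * k)%R|%N.+1)) ltn_exp2r ?prime_gt1.
  have N_rho : rho.-nat N by rewrite pnatX pnatE ?p_rho.
  have [theta [thV thA]] := signed_representation lam_neq0 c0 c_tree N_gt1 slope_sign.
  apply: (finite_quotient thA).
  - exact: signed_group_rho.
  - exact: signed_group_solvable.
  - rewrite Dg thV -(sperm1 N) => /sperm_inj/eqP; rewrite Zn_intr_eq0 //.
    move=> N_dvd; apply: g1; rewrite Dg.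
    suff -> : k = 0%R by [].
    apply/eqP; have : `|(c v0 * k)%R|%N == 0%N.
      by apply: contraLR N_gt; rewrite -lt0n -leqNgt => ck_gt0; exact: dvdn_leq.
    by rewrite absz_eq0 mulf_eq0 => /orP[/eqP/c0|].
(* Being a multiple of each [lab z * c (source z)], [N] lets residues modulo [N] detect divisibility
   by labels; the factor [p] ensures that [N] exceeds 1. *)
pose N := (p * \prod_(z : E * bool) `|(lab z * c (source z))%R|)%N.
have N_rho : rho.-nat N.
  rewrite pnatM pnatE ?p_rho //=; apply: (big_ind (fun n => rho.-nat n)) => // [m n|z _].
    by rewrite pnatM => -> ->.
  by rewrite abszM pnatM c_rho lam_rho.
have N_gt1 : (1 < N)%N.
  apply: leq_trans (prime_gt1 p_pr) _; rewrite leq_pmulr //.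
  by have /andP[+ _] := N_rho; rewrite muln_gt0 => /andP[].
have [theta [thV thA]] := signed_representation lam_neq0 c0 c_tree N_gt1 slope_sign.
pose A := signed_group N (2%N \in rho).
pose th h : subg_of A := subg A (theta h).
have thM : {morph th : h h' / h * h'} by move=> h1 h2; rewrite /th gmulfM morphM.
pose theta' := HB.pack_for {multiplicative G -> subg_of A} th (isMultiplicative.Build _ _ th thM).
have faithful z l l' : theta' (expgz (a_ (source z)) l)
    = theta' (expgz (a_ (source z)) (lab z * l')%R) -> divides (lab z) l.
  move/(congr1 sgval); rewrite /= /th !subgK // !thV => /sperm_inj/eqP.
  rewrite -subr_eq0 -rmorphB /= Zn_intr_eq0 // -mulrBr => N_dvd.
  have : (`|(lab z * c (source z))%R| %| `|(c (source z) * (l - lab z * l'))%R|)%N.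
    by apply: dvdn_trans N_dvd; rewrite /N (bigD1 z) //= mulnCA dvdn_mulr.
  rewrite mulrC !abszM dvdn_pmul2l; last by rewrite absz_gt0; apply/eqP.
  move=> lab_dvd; have /dvdzP[q Dq] : (lab z %| (l - lab z * l')%R)%Z by [].
  exists (q + l')%R.
  by rewrite mulrDr [(lab z * q)%R]mulrC -Dq subrK.
have rhoA : rho.-group [set: subg_of A]%SET.
  by rewrite -im_subg morphim_pgroup // signed_group_rho.
have solA : solvable [set: subg_of A]%SET.
  by rewrite -im_subg morphim_sol // signed_group_solvable.
have [H [sigma [CH onto sg]]] := finite_detection T_max (k + j)%R p_pr p_rho
  rhoA solA faithful red (etrans xv0 (esym yv0)).
exists H, sigma; split=> // sg1; apply: sg.
(* Conjugation gathers both outer vertex powers at the end. *)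
have -> : h * expgz (a_ (source x)) (k + j)%R = g ^ expgz (a_ v0) j.
  by rewrite Dg xv0 conjgE expgzD !mulgA mulVg mul1g.
by rewrite multJ sg1 conj1g.
Qed.

End Conclusion.

Lemma residually_mono (C D : groupType -> Prop) (G : groupType) :
  (forall H, C H -> D H) -> residually C G -> residually D G.
Proof. by move=> CD res g /res[H [f [/CD DH onto fg]]]; exists H, f. Qed.

Theorem corollary2
  (Gamma : graph) (lam : labeling Gamma)
  (Gamma_nonempty : (0 < #|vertex Gamma|)%N)
  (Gamma_connected : connected_graph Gamma)
  (lam_neq0 : forall e b, lam e b <> 0%R)
  (VT : {set vertex Gamma}) (ET : {set edge Gamma})
  (T_max : maximal_subtree VT ET)
  (G_nonsolvable : ~ solvable_group (gbs_group lam ET))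
  (lam_reduced : reduced_labeling lam)
  (rho : nat_pred)
  (rho_primes : forall p, p \in rho -> prime p)
  (rho_nonempty : exists p, p \in rho) :
  [<->
    residually (fun H => finite_group H /\ rho_group rho H) (gbs_group lam ET);
    residually (fun H => [/\ finite_group H, solvable_group H & rho_group rho H])
      (gbs_group lam ET);
    residually (fun H => rho_group rho H /\ finite_exponent H)
      (gbs_group lam ET);
    residually (fun H => [/\ solvable_group H, rho_group rho H & finite_exponent H])
      (gbs_group lam ET);
    [/\ range (Delta lam ET) `<=` [set 1%R; (-1)%R],
        forall e b, rho.-nat `|lam e b|%N
      & range (Delta lam ET) (-1)%R -> 2%N \in rho]
  ]%classic.
Proof.
have to_delta (C : groupType -> Prop) : (forall H, C H -> rho_group rho H) ->
    residually C (gbs_group lam ET) -> delta_condition lam ET rho.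
  move=> C_rho /(residually_mono C_rho).
  exact: (delta_condition_of_residual Gamma_nonempty Gamma_connected T_max).
have of_delta (C : groupType -> Prop) : (forall H, finite_solvable_rho rho H -> C H) ->
    delta_condition lam ET rho -> residually C (gbs_group lam ET).
  move=> C_fin delta; apply: residually_mono C_fin _.
  exact: (residual_of_delta_condition Gamma_nonempty Gamma_connected T_max).
(* The first three implications pass through the last condition, which yields the strongest residual
   property. *)
tfae.
- by move=> /to_delta res; apply: of_delta => [H []//|]; apply: res => H [].
- by move=> /to_delta res; apply: of_delta => [H []//|]; apply: res => H [].
- by move=> /to_delta res; apply: of_delta => [H []//|]; apply: res => H [].
- by move=> /to_delta res; apply: res => H [].
- by apply: of_delta => H [].
Qed.
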